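(* Suppose the embedded jump chain $(\tilde\xi_n)$ is recurrent. (1) The following are equivalent: (i) there exist $f\in\mathrm{Dom}_+(\Gamma)$ with $\sup_{x\in\mathbb X}f(x)=b<\infty$, a number $a\in(0,b)$ such that $\{f\le a\}$ is finite, and $\epsilon>0$ such that $\Gamma f(x)\le-\epsilon$ for all $x\notin\{f\le a\}$; (ii) for every nonempty finite $A\subset\mathbb X$ there exists a constant $C_A>0$ such that $\mathbb E_x\tau_A\le C_A$ for all $x\notin A$. (2) Let $f\in\mathrm{Dom}_+(\Gamma)$ with $f\to\infty$, and suppose there exist constants $a>0$, $c>0$, $\epsilon>0$ and $r>1$ such that $f^r\in\mathrm{Dom}_+(\Gamma)$, $\Gamma f(x)\ge-\epsilon$ for all $x\notin\{f\le a\}$, and $\Gamma f^r(x)\le c\,f^{r-1}(x)$ for all $x\notin\{f\le a\}$. Then the chain does not implode towards $\{f\le a\}$, i.e.\ there is no $K>0$ with $\mathbb E_x\tau_{\{f\le a\}}\le K$ for all $x\notin\{f\le a\}$.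
   Context: Let $\mathbb X$ be a countably infinite set and $\Gamma=(\Gamma_{xy})_{x,y\in\mathbb X}$ a matrix with $\Gamma_{xy}\ge0$ for $y\ne x$, $\gamma_x:=\sum_{y\ne x}\Gamma_{xy}$, $\Gamma_{xx}=-\gamma_x$, and $0<\gamma_x<\infty$ for all $x$. Let $P_{xy}=\Gamma_{xy}/\gamma_x$ for $y\neq x$ and $P_{xx}=0$; the discrete-time chain $(\tilde\xi_n)$ with transition matrix $P$ (embedded jump chain) is assumed irreducible. The continuous-time Markov chain $(\xi_t)_{t\ge0}$ with generator $\Gamma$: conditionally on $\tilde\xi$, holding times $\sigma_n$ ($n\ge1$) are independent exponential with parameter $\gamma_{\tilde\xi_{n-1}}$; $J_0=0$, $J_n=\sigma_1+\dots+\sigma_n$, $\zeta=\lim_nJ_n$; $\xi_t=\tilde\xi_n$ on $[J_n,J_{n+1})$, $\xi_t=\partial$ for $t\ge\zeta$. $\mathbb E_x$ refers to $\xi_0=x$; $\tau_A=\inf\{t\ge0:\xi_t\in A\}$. $\mathrm{Dom}(\Gamma)=\{f:\mathbb X\to\mathbb R:\ \sum_{y\ne x}\Gamma_{xy}|f(y)|<\infty\ \forall x\}$, $\mathrm{Dom}_+(\Gamma)$ its non-negative elements, $\Gamma f(x)=\sum_{y}\Gamma_{xy}f(y)$. $\{f\le\alpha\}:=\{x:f(x)\le\alpha\}$; ''$f\to\infty$'' means $\{f\le n\}$ is finite for all $n\in\mathbb N$. The chain implodes towards a proper subset $A$ if there is $K>0$ with $\mathbb E_x\tau_A\le K$ for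 all $x\in A^c$. *)

(* Defs.v *)
From HB Require Import structures.
From mathcomp Require Import all_boot all_order all_algebra.
From mathcomp Require Import all_classical all_reals all_analysis.
From Stdlib Require Import Relations.Relation_Operators.

Set Implicit Arguments.
Unset Strict Implicit.
Unset Printing Implicit Defensive.

Import Order.TTheory GRing.Theory Num.Theory.
Local Open Scope classical_set_scope.
Local Open Scope ring_scope.

Section Defs.
Variables (R : realType) (X : countType) (Gamma : X -> X -> R).

Definition gammaE (x : X) : \bar R :=
  (\esum_(y in [set y | y != x]) (Gamma x y)%:E)%E.
Definition gamma (x : X) : R := fine (gammaE x).

Definition Qmatrix : Prop :=
  (forall x y, y != x -> 0 <= Gamma x y) /\
  (forall x, (0 < gammaE x)%E /\ (gammaE x < +oo)%E) /\
  (forall x, Gamma x x = - gamma x).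

Definition Pmat (x y : X) : R := if y == x then 0 else Gamma x y / gamma x.

Definition jump_irreducible : Prop :=
  forall x y, clos_refl_trans X (fun u v => 0 < Pmat u v) x y.

Definition inDom (f : X -> R) : Prop :=
  forall x, (\esum_(y in [set y | y != x]) (Gamma x y * `|f y|)%:E < +oo)%E.
Definition inDomP (f : X -> R) : Prop := inDom f /\ forall x, 0 <= f x.

(* Gamma f (x) = Gamma_xx f(x) + sum_{y<>x} Gamma_xy f(y), the (absolutely
   convergent) series being split into positive and negative parts *)
Definition gen (f : X -> R) (x : X) : R :=
  Gamma x x * f x
  + fine (\esum_(y in [set y | y != x]) (Gamma x y * Num.max (f y) 0)%:E)%E
  - fine (\esum_(y in [set y | y != x]) (Gamma x y * Num.max (- f y) 0)%:E)%E.

Definition sublevel (f : X -> R) (alpha : R) : set X := [set x | f x <= alpha].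

Definition tends_to_infty (f : X -> R) : Prop :=
  forall n : nat, finite_set (sublevel f n%:R).

(* A realization of the continuous-time chain with generator Gamma, under the
   family of probabilities Px (Px x corresponds to xi_0 = x):
   xi n = tilde xi_n (jump chain), hold n = sigma_{n+1} (holding time in
   tilde xi_n).  The joint law is prescribed on the pi-system of cylinder
   events, which determines it: the jump chain is Markov(P) started at x and,
   conditionally on it, the holding times are independent exponentials with
   parameters gamma(tilde xi_n). *)
Definition CTMC_realization (d : measure_display) (Omega : measurableType d)
  (Px : X -> probability Omega R) (xi : nat -> Omega -> X)
  (hold : nat -> Omega -> R) : Prop :=
  (forall n y, measurable (xi n @^-1` [set y])) /\
  (forall n, measurable_fun setT (hold n)) /\
  (forall x (n : nat) (s : nat -> X) (t : nat -> R), (forall k, 0 <= t k) ->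
     Px x [set w | (forall k, (k <= n)%N -> xi k w = s k) /\
                   (forall k, (k < n)%N -> t k < hold k w)]
     = ((if s 0%N == x then 1 else 0) *
        \prod_(k < n) (Pmat (s k) (s k.+1) * expR (- gamma (s k) * t k)))%:E).

Definition jumpT (Omega : Type) (hold : nat -> Omega -> R) (n : nat) (w : Omega) : R :=
  \sum_(k < n) hold k w.

(* xi_t(w) in A  (xi_t = tilde xi_n on [J_n, J_{n+1}), = cemetery for t >= zeta) *)
Definition in_at (Omega : Type) (xi : nat -> Omega -> X) (hold : nat -> Omega -> R)
  (A : set X) (t : R) (w : Omega) : Prop :=
  exists n, jumpT hold n w <= t /\ t < jumpT hold n.+1 w /\ A (xi n w).

(* tau_A = inf {t >= 0 : xi_t in A}  (inf of the empty set = +oo) *)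
Definition hitting_time (Omega : Type) (xi : nat -> Omega -> X)
  (hold : nat -> Omega -> R) (A : set X) (w : Omega) : \bar R :=
  ereal_inf [set (t%:E)%E | t in [set t : R | 0 <= t /\ in_at xi hold A t w]].

Definition Etau (d : measure_display) (Omega : measurableType d)
  (Px : X -> probability Omega R) (xi : nat -> Omega -> X)
  (hold : nat -> Omega -> R) (A : set X) (x : X) : \bar R :=
  (\int[Px x]_w hitting_time xi hold A w)%E.

Definition jump_recurrent (d : measure_display) (Omega : measurableType d)
  (Px : X -> probability Omega R) (xi : nat -> Omega -> X) : Prop :=
  forall x, Px x [set w | exists n, (0 < n)%N /\ xi n w = x] = 1%E.

End Defs.

(* Main.v *)
Require Import Defs.
From HB Require Import structures.
From mathcomp Require Import all_boot all_order all_algebra.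
From mathcomp Require Import all_classical all_reals all_analysis.
From mathcomp Require Import measurable_realfun ring lra.
From Stdlib Require Import Relations.Relation_Operators.

(** Let [P] be the transition operator of the jump chain and [rho = 1 / gamma].
    Started off [A], the mean hitting time of [A] is the potential
    [sum_n Q^n rho], where [Q] is [P] killed on [A]: almost surely the holding
    times are positive and, by recurrence and irreducibility, [A] is visited, so
    the hitting time is the sum of the holding times spent before. The potential
    [h] solves [h = rho + Q h] and is below every [g >= 0] with [rho + P g <= g]
    off [A], and [Gamma f = gamma (P f - f)]; the rest is potential theory.

    (i) => (ii): [f / eps] is a supersolution off the finite set [F = {f <= a}].
    Adding a large multiple of [1 - E 2^(-T)], with [T] a truncation of the
    number of jumps to [A], makes it a supersolution off [A], because [2^(-T)]
    has a strictly positive drift on [F].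
    (ii) => (i): take [f = 1 + h] off a singleton [A] and [f = 0] on it.

    (2) Suppose [h <= K]. For [1/r < s < 1] and [C] large,
    [U = (f^r + C)^s (1 + h)^(1 - s)] satisfies [P U <= U] off [F], by the
    weighted AM-GM inequality: this is uniform integrability of [f] along the
    chain stopped on [F], as [U >= f^(r s)]. Hence optional stopping applies to
    the submartingale given by [f - eps h], and [f <= a + eps K] everywhere,
    which contradicts [f -> oo]. *)

Set Implicit Arguments.
Unset Strict Implicit.
Unset Printing Implicit Defensive.

Import Order.TTheory GRing.Theory Num.Theory.
Import numFieldNormedType.Exports.
Local Open Scope classical_set_scope.
Local Open Scope ring_scope.

(** * Countable sums *)

Section esum_facts.
Context {R : realType} {T : choiceType}.
Local Open Scope ereal_scope.

(** Finite subsums give one inequality for every constant; the converse is that inequality for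
    [c^-1] applied to [c * a]. *)
Lemma esumZl (I : set T) (c : R) (a : T -> \bar R) : (0 <= c)%R ->
  (forall i, 0 <= a i) ->
  \esum_(i in I) (c%:E * a i) = c%:E * \esum_(i in I) a i.
Proof.
have le (b : R) (u : T -> \bar R) : (0 <= b)%R -> (forall i, 0 <= u i) ->
    \esum_(i in I) (b%:E * u i) <= b%:E * \esum_(i in I) u i.
  move=> b0 u0; apply: ge_ereal_sup => _ [F [finF FI] <-].
  rewrite fsbig_finite//= -ge0_sume_distrr//.
  rewrite lee_wpmul2l ?lee_fin//; apply: esum_ge; exists F => //.
  by rewrite fsbig_finite.
rewrite le_eqVlt => /predU1P[<- a0|c0 a0].
  by rewrite mul0e esum1// => i _; rewrite mul0e.
apply/eqP; rewrite eq_le le ?(ltW c0)//=.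
rewrite -lee_pdivlMl// (le_trans _ (le _ _ _ _))//.
- by apply: le_esum => i _; rewrite muleA -EFinM mulVf ?gt_eqF// mul1e.
- by rewrite invr_ge0 ltW.
- by move=> i; rewrite mule_ge0// lee_fin ltW.
Qed.

Lemma esum_nneseries (a : T -> nat -> \bar R) :
  (forall y n, 0 <= a y n) ->
  \esum_(y in [set: T]) (\sum_(n <oo) a y n) =
  \sum_(n <oo) \esum_(y in [set: T]) a y n.
Proof.
move=> a0; rewrite nneseries_esumT; last by move=> n; exact: esum_ge0.
under eq_esum do rewrite nneseries_esumT//.
rewrite esum_esum// esum_esum//.
rewrite (reindex_esum ([set: nat] `*`` (fun=> [set: T])) _ (fun z => (z.2, z.1)))//.
split=> //.
- by move=> [? ?] [? ?] _ _ [-> ->].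
- by move=> [y n] _; exists (n, y).
Qed.

End esum_facts.

(** * Countable additivity over a countable index type *)

Section measure_countable.
Context {R : realType} {d : measure_display} {Omega : measurableType d}.
Context {X : countType}.

Lemma measurable_countType_bigcup (D : set X) (E : X -> set Omega) :
  (forall y, D y -> measurable (E y)) -> measurable (\bigcup_(y in D) E y).
Proof.
move=> mE; rewrite bigcup_mkcond; apply: countable_bigcupT_measurable => // y.
by case: ifPn => // /set_mem; exact: mE.
Qed.

(** [mu] is a bare set function because it will also be the integral of a holding time over an
    event, or a probability restricted to an event. *)
Lemma additive_countType_bigcup (mu : set Omega -> \bar R) :
  mu set0 = 0%E -> (forall A, 0 <= mu A)%E ->
  (forall F : nat -> set Omega, (forall n, measurable (F n)) ->
    trivIset [set: nat] F -> mu (\bigcup_n F n) = (\sum_(n <oo) mu (F n))%E) ->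
  forall (D : set X) (E : X -> set Omega),
  (forall y, D y -> measurable (E y)) -> trivIset D E ->
  mu (\bigcup_(y in D) E y) = (\esum_(y in D) mu (E y))%E.
Proof.
move=> mu0 mu_ge0 mu_add D E mE tE.
pose F n := if pickle_inv n is Some y then if y \in D then E y else set0 else set0.
have FE y : D y -> F (pickle y) = E y.
  by move=> Dy; rewrite /F pickleK_inv mem_set.
have -> : \bigcup_(y in D) E y = \bigcup_n F n.
  apply/seteqP; split=> w.
    by move=> [y Dy Ey]; exists (pickle y) => //; rewrite FE.
  move=> [n _]; rewrite /F; case: (pickle_inv n) => // y.
  by case: ifPn => // /set_mem Dy Ew; exists y.
rewrite mu_add; last 2 first.
- move=> n; rewrite /F; case: (pickle_inv n) => // y.
  by case: ifPn => // /set_mem; exact: mE.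
- apply/trivIsetP => i j _ _ ij; rewrite /F.
  case Ei: (pickle_inv i) => [y|]; last by rewrite set0I.
  case Ej: (pickle_inv j) => [z|]; last by rewrite setI0.
  case: ifPn => [/set_mem Dy|_]; last by rewrite set0I.
  case: ifPn => [/set_mem Dz|_]; last by rewrite setI0.
  move/trivIsetP : tE; apply => //; apply: contra_neq ij => yz.
  have := @pickle_invK X i; rewrite Ei /= => <-.
  by have := @pickle_invK X j; rewrite Ej /= => <-; rewrite yz.
rewrite nneseries_esumT//.
rewrite [RHS](_ : _ = (\esum_(y in D) mu (F (pickle y)))%E); last first.
  by apply: eq_esum => y Dy; rewrite FE.
rewrite -(@reindex_esum _ _ _ D (pickle @` D) pickle (fun n => mu (F n)))//; last first.
  by split=> // y z _ _; exact: (pcan_inj (@pickleK X)).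
rewrite [RHS]esum_mkcond; apply: eq_esum => n _.
case: ifPn => // /negP nD; rewrite /F; case En: (pickle_inv n) => [y|]; last first.
  by [].
case: ifPn => [/set_mem Dy|_]; last by [].
exfalso; apply: nD; apply/mem_set; exists y => //.
by have := @pickle_invK X n; rewrite En.
Qed.

End measure_countable.

(** * The jump operator and its killed iterates *)

Section jump_operator.
Context {R : realType} {X : countType}.
Variable Gamma : X -> X -> R.
Hypothesis QG : Qmatrix Gamma.
Local Open Scope ereal_scope.
Implicit Types (A : set X) (g : X -> \bar R) (x y : X) (n : nat).

Definition Pop g x := \esum_(y in [set: X]) ((Pmat Gamma x y)%:E * g y).

Definition kill A g y := if y \in A then 0 else g y.

(* [Qiter A n g x] is the expectation of [g] at step [n] on the event that the jump
   chain started at [x] avoids [A] at steps [1] to [n]; step [0] is not tested. *)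
Definition Qiter A n g := iter n (fun h => Pop (kill A h)) g.

Lemma Gamma_ge0 x y : y != x -> (0 <= Gamma x y)%R.
Proof. by case: QG => + _; exact. Qed.

Lemma gammaEE x : gammaE Gamma x = (gamma Gamma x)%:E.
Proof.
case: QG => _ [/(_ x)[g0 gy] _]; rewrite /gamma fineK// ge0_fin_numE//.
exact: ltW.
Qed.

Lemma gamma_gt0 x : (0 < gamma Gamma x)%R.
Proof. by case: QG => _ [/(_ x)[+ _] _]; rewrite gammaEE lte_fin. Qed.

Lemma Pmat_ge0 x y : (0 <= Pmat Gamma x y)%R.
Proof.
rewrite /Pmat; case: eqP => [//|/eqP yx].
by rewrite divr_ge0 ?Gamma_ge0// ltW// gamma_gt0.
Qed.

Lemma Pop_ge0 g x : (forall y, 0 <= g y) -> 0 <= Pop g x.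
Proof. by move=> g0; apply: esum_ge0 => y _; rewrite mule_ge0// lee_fin Pmat_ge0. Qed.

Lemma le_Pop g h x : (forall y, g y <= h y) -> Pop g x <= Pop h x.
Proof. by move=> gh; apply: le_esum => y _; rewrite lee_wpmul2l// lee_fin Pmat_ge0. Qed.

Lemma PopD g h x : (forall y, 0 <= g y) -> (forall y, 0 <= h y) ->
  Pop (fun y => g y + h y) x = Pop g x + Pop h x.
Proof.
move=> g0 h0; rewrite /Pop -esumD; last 2 first.
- by move=> y _; rewrite mule_ge0// lee_fin Pmat_ge0.
- by move=> y _; rewrite mule_ge0// lee_fin Pmat_ge0.
by apply: eq_esum => y _; rewrite ge0_muleDr.
Qed.

Lemma PopZ (c : R) g x : (0 <= c)%R -> (forall y, 0 <= g y) ->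
  Pop (fun y => c%:E * g y) x = c%:E * Pop g x.
Proof.
move=> c0 g0; rewrite /Pop -esumZl//; last first.
  by move=> y; rewrite mule_ge0// lee_fin Pmat_ge0.
by apply: eq_esum => y _; rewrite muleCA.
Qed.

Lemma Pop_gamma (f : X -> R) x : (forall y, 0 <= f y)%R ->
  (gamma Gamma x)%:E * Pop (fun y => (f y)%:E) x =
  \esum_(y in [set y | y != x]) (Gamma x y * f y)%:E.
Proof.
move=> f0; rewrite /Pop -esumZl//; last 2 first.
- exact/ltW/gamma_gt0.
- by move=> y; rewrite mule_ge0// lee_fin ?Pmat_ge0.
rewrite [RHS]esum_mkcond; apply: eq_esum => y _; rewrite /Pmat.
case: eqP => [->|/eqP yx]; first by rewrite memNset/= ?eqxx// mul0e mule0.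
rewrite mem_set//= -!EFinM; congr EFin.
by rewrite mulrA mulrCA divff ?mulr1// gt_eqF// gamma_gt0.
Qed.

(** [P] is stochastic: [gamma] times its row sum is [gammaE]. *)
Lemma Pop_cst (c : R) x : (0 <= c)%R -> Pop (fun=> c%:E) x = c%:E.
Proof.
move=> c0; rewrite -[RHS]mule1 -(_ : Pop (fun=> 1%:E) x = 1); last first.
  have g0 : (gamma Gamma x != 0)%R by rewrite gt_eqF// gamma_gt0.
  transitivity (((gamma Gamma x)^-1 * gamma Gamma x)%:E * Pop (fun=> 1%:E) x).
    by rewrite mulVf// mul1e.
  rewrite EFinM -muleA.
  have /= -> := @Pop_gamma (fun=> 1%R) x (fun=> ler01).
  rewrite [X in _ * X](_ : _ = (gamma Gamma x)%:E); last first.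
    by rewrite -gammaEE; apply: eq_esum => y _; rewrite mulr1.
  by rewrite -EFinM mulVf.
by rewrite -PopZ//; congr Pop; apply/funext => y; rewrite mule1.
Qed.

Lemma Pop_ge g x y : (forall y, 0 <= g y) -> (Pmat Gamma x y)%:E * g y <= Pop g x.
Proof.
move=> g0; rewrite -[leLHS](@esum_set1 _ _ y (fun y => (Pmat Gamma x y)%:E * g y)).
  rewrite esum_mkcond; apply: le_esum => z _; case: ifPn => // _.
  by rewrite mule_ge0// lee_fin Pmat_ge0.
by rewrite mule_ge0// lee_fin Pmat_ge0.
Qed.

Lemma Pop_nneseries (g : nat -> X -> \bar R) x : (forall n y, 0 <= g n y) ->
  Pop (fun y => \sum_(n <oo) g n y) x = \sum_(n <oo) Pop (g n) x.
Proof.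
move=> g0; rewrite /Pop -esum_nneseries; last first.
  by move=> y n; rewrite mule_ge0// lee_fin Pmat_ge0.
by apply: eq_esum => y _; rewrite nneseriesZl.
Qed.

Lemma kill_ge0 A g y : (forall y, 0 <= g y) -> 0 <= kill A g y.
Proof. by move=> g0; rewrite /kill; case: ifP. Qed.

Lemma le_kill A g h : (forall y, ~ A y -> g y <= h y) ->
  forall y, kill A g y <= kill A h y.
Proof. by move=> gh y; rewrite /kill; case: ifPn => //; rewrite notin_setE => /gh. Qed.

Lemma kill_le A g y : (forall y, 0 <= g y) -> kill A g y <= g y.
Proof. by move=> g0; rewrite /kill; case: ifP. Qed.

Lemma Qiter_ge0 A n g x : (forall y, 0 <= g y) -> 0 <= Qiter A n g x.
Proof.
by move=> g0; elim: n x => [//|n IH] x /=; apply: Pop_ge0 => y; exact: kill_ge0.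
Qed.

Lemma Qiter_set0_cst n x : Qiter set0 n (fun=> 1%:E) x = 1.
Proof.
elim: n x => [//|n IH] x /=; rewrite -[RHS](@Pop_cst 1%R x)//.
by congr Pop; apply/funext => y; rewrite /kill memNset// -[RHS](IH y).
Qed.

(* The first holding time is counted even if [x] is in [A], so that this is the
   mean hitting time of [A] only off [A]. *)
Definition potential A x := \sum_(n <oo) Qiter A n (fun y => (gamma Gamma y)^-1%:E) x.

Lemma rate_inv_ge0 y : 0 <= (gamma Gamma y)^-1%:E.
Proof. by rewrite lee_fin invr_ge0 ltW// gamma_gt0. Qed.

Lemma potential_ge0 A x : 0 <= potential A x.
Proof. by apply: nneseries_ge0 => n _ _; apply: Qiter_ge0; exact: rate_inv_ge0. Qed.

(** First-jump decomposition: the term [n = 0] is split off and [Pop] is exchanged with the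
    remaining nonnegative series. *)
Lemma potentialE A x :
  potential A x = (gamma Gamma x)^-1%:E + Pop (kill A (potential A)) x.
Proof.
rewrite /potential nneseries_recl//; last first.
  by move=> n _; apply: Qiter_ge0; exact: rate_inv_ge0.
congr (_ + _); rewrite -nneseries_addn; last first.
  by move=> n; apply: Qiter_ge0; exact: rate_inv_ge0.
under eq_eseriesr do rewrite addn1 /=.
rewrite -Pop_nneseries; last first.
  by move=> n y; apply: kill_ge0 => z; apply: Qiter_ge0; exact: rate_inv_ge0.
congr Pop; apply/funext => y; rewrite /kill; case: ifP => // _.
by rewrite eseries0.
Qed.

(** Minimality of the potential, by induction on its partial sums; killing discards the values on
    [A], where [g] is not controlled. *)
Lemma potential_le A g : (forall y, 0 <= g y) ->
  (forall x, ~ A x -> (gamma Gamma x)^-1%:E + Pop g x <= g x) ->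
  forall x, ~ A x -> potential A x <= g x.
Proof.
move=> g0 gP.
suff H n x : ~ A x ->
    \sum_(0 <= k < n) Qiter A k (fun y => (gamma Gamma y)^-1%:E) x <= g x.
  move=> x Ax; apply: lime_le.
    by apply: is_cvg_nneseries => k _ _; apply: Qiter_ge0; exact: rate_inv_ge0.
  by apply: nearW => n; exact: H.
elim: n x => [|n IH] x Ax; first by rewrite big_geq.
rewrite big_nat_recl//=; apply: le_trans (gP _ Ax); rewrite leeD2l//.
have -> : \sum_(0 <= i < n)
      Pop (kill A (Qiter A i (fun y => (gamma Gamma y)^-1%:E))) x =
    Pop (kill A (fun y => \sum_(0 <= i < n)
      Qiter A i (fun y => (gamma Gamma y)^-1%:E) y)) x.
  rewrite /Pop -esum_sum; last first.
    move=> y k _ _; rewrite mule_ge0 ?lee_fin ?Pmat_ge0// kill_ge0// => z.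
    by apply: Qiter_ge0; exact: rate_inv_ge0.
  apply: eq_esum => y _; rewrite /kill; case: ifP => // _.
    by rewrite mule0 big1// => i _; rewrite mule0.
  rewrite ge0_sume_distrr// => i _; apply: Qiter_ge0; exact: rate_inv_ge0.
apply: le_trans (le_Pop _ (fun y => kill_le A y g0)).
by apply: le_Pop; apply: le_kill.
Qed.

(** The domain condition makes [P f] finite because [gamma > 0], and the negative-part series in
    [gen] vanishes for [f >= 0]. *)
Lemma inDomP_Pop (f : X -> R) x : inDomP Gamma f ->
  exists2 p : R, Pop (fun y => (f y)%:E) x = p%:E &
    gen Gamma f x = (gamma Gamma x * (p - f x))%R.
Proof.
move=> [Df f0]; have := Pop_gamma x f0.
have -> : \esum_(y in [set y | y != x]) (Gamma x y * f y)%:E =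
    \esum_(y in [set y | y != x]) (Gamma x y * `|f y|)%:E.
  by apply: eq_esum => y _; rewrite ger0_norm.
move=> PE.
have Py : Pop (fun y => (f y)%:E) x < +oo.
  rewrite ltey; apply/eqP => Poo; move: (Df x); rewrite -PE Poo.
  by rewrite gt0_muley ?lte_fin ?gamma_gt0// ltxx.
have P0 : 0 <= Pop (fun y => (f y)%:E) x by apply: Pop_ge0 => y; rewrite lee_fin.
exists (fine (Pop (fun y => (f y)%:E) x)); first by rewrite fineK// ge0_fin_numE.
have Gxx : Gamma x x = (- gamma Gamma x)%R by case: QG => _ [_].
rewrite /gen Gxx [X in (_ + fine X - _)%R](_ : _ =
    (gamma Gamma x)%:E * Pop (fun y => (f y)%:E) x); last first.
  by rewrite PE; apply: eq_esum => y _; rewrite ger0_norm// max_l.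
rewrite [X in (_ - fine X)%R](_ : _ = 0); last first.
  by apply: esum1 => y _; rewrite max_r ?mulr0// oppr_le0.
rewrite fineM//; last by rewrite ge0_fin_numE.
by rewrite /= subr0 mulrBr mulNr addrC.
Qed.

End jump_operator.

(** * Lyapunov functions for bounded mean hitting times *)

Lemma finite_set_bounded {R : realType} {X : choiceType} (F : set X) (q : X -> R) :
  finite_set F -> exists2 M : R, 0 <= M & forall x, F x -> q x <= M.
Proof.
move=> finF; exists (\sum_(x <- finmap.enum_fset (fset_set F)) `|q x|).
  by rewrite sumr_ge0.
move=> x Fx; apply: le_trans (ler_norm _) _.
rewrite (big_rem x) /=; last first.
  by have := in_fset_set finF x; rewrite mem_set.
by rewrite lerDl sumr_ge0.
Qed.

Section lyapunov_bounded.
Context {R : realType} {X : countType}.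
Variable Gamma : X -> X -> R.
Hypothesis QG : Qmatrix Gamma.
Implicit Types (A : set X) (g f : X -> R) (x y : X) (n : nat).

Definition PopR g x : R := fine (Pop Gamma (fun y => (g y)%:E) x).

Lemma PopRE g (c : R) x : (forall y, 0 <= g y) -> (forall y, g y <= c) ->
  Pop Gamma (fun y => (g y)%:E) x = (PopR g x)%:E.
Proof.
move=> g0 gc; have c0 : 0 <= c := le_trans (g0 x) (gc x).
rewrite /PopR fineK// ge0_fin_numE; last by apply: Pop_ge0 => // y; rewrite lee_fin.
apply: (@le_lt_trans _ _ c%:E); last by rewrite ltry.
by rewrite -(Pop_cst QG x c0); apply: le_Pop => // y; rewrite lee_fin.
Qed.

(* [1 - E_x (2^(-T); T <= n)], where [T] is the number of jumps needed to reach [A]. *)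
Fixpoint miss A n x : R :=
  if x \in A then 0 else
  if n is n'.+1 then (1 + PopR (miss A n') x) / 2 else 1.

Lemma missS A n x :
  miss A n.+1 x = if x \in A then 0 else (1 + PopR (miss A n) x) / 2.
Proof. by []. Qed.

Lemma miss_in A n x : A x -> miss A n x = 0.
Proof. by move=> Ax; case: n => [|n] /=; rewrite mem_set. Qed.

Lemma miss_bounds A n x : 0 <= miss A n x <= 1.
Proof.
elim: n x => [|n IH] x /=; case: ifP => _; rewrite ?lexx ?ler01//.
have miss0 y : 0 <= miss A n y by case/andP: (IH y).
have miss1 y : miss A n y <= 1 by case/andP: (IH y).
have : 0 <= PopR (miss A n) x.
  by rewrite -lee_fin -(PopRE x miss0 miss1) Pop_ge0// => y; rewrite lee_fin.
have : PopR (miss A n) x <= 1.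
  rewrite -lee_fin -(PopRE x miss0 miss1) -(Pop_cst QG x ler01).
  by apply: le_Pop => // y; rewrite lee_fin.
by move=> ? ?; apply/andP; split; lra.
Qed.

Lemma miss_ge0 A n x : 0 <= miss A n x.
Proof. by case/andP: (miss_bounds A n x). Qed.

Lemma miss_le1 A n x : miss A n x <= 1.
Proof. by case/andP: (miss_bounds A n x). Qed.

Lemma PopR_missE A n x :
  Pop Gamma (fun y => (miss A n y)%:E) x = (PopR (miss A n) x)%:E.
Proof. exact: PopRE (miss_ge0 A n) (miss_le1 A n). Qed.

Lemma missS_le A n x : miss A n.+1 x <= miss A n x.
Proof.
elim: n x => [|n IH] x.
  by have := miss_le1 A 1 x => /=; case: ifP.
have : PopR (miss A n.+1) x <= PopR (miss A n) x.
  rewrite -lee_fin -!PopR_missE; apply: le_Pop => // y; rewrite lee_fin; exact: IH.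
rewrite (missS A n.+1) (missS A n); case: ifP => // _ H.
by rewrite ler_pM2r ?invr_gt0// lerD2l.
Qed.

Lemma miss_mono A m n x : (m <= n)%N -> miss A n x <= miss A m x.
Proof.
move/subnK <-; elim: (n - m)%N => [//|k IH]; rewrite addSn.
exact: le_trans (missS_le _ _ _) IH.
Qed.

(** This combines the recursion with monotonicity in [n]. Read as [1 - V <= V - P V] with
    [V = miss A n], it is a drift that is strict wherever [V < 1]. *)
Lemma PopR_miss_le A n x : ~ A x -> PopR (miss A n) x + 1 <= 2 * miss A n x.
Proof.
move=> Ax; have := missS_le A n x; rewrite missS memNset// => H; lra.
Qed.

(** [P V + P (1 - V) = 1], and the transition to [y] alone makes the second term positive. *)
Lemma miss_lt1_step A n x y : 0 < Pmat Gamma x y -> miss A n y < 1 ->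
  miss A n.+1 x < 1.
Proof.
move=> Pxy y1; have [Ax|Ax] := pselect (A x); first by rewrite miss_in.
suff : PopR (miss A n) x < 1 by move=> ?; rewrite missS memNset//; lra.
have miss0 z : 0 <= 1 - miss A n z by rewrite subr_ge0 miss_le1.
have miss1 z : 1 - miss A n z <= 1 by rewrite gerBl miss_ge0.
have : (Pop Gamma (fun y => (miss A n y)%:E) x +
        Pop Gamma (fun y => (1 - miss A n y)%:E) x = 1)%E.
  rewrite -PopD//; last first.
    by move=> z; rewrite lee_fin miss_ge0.
  rewrite -[RHS](Pop_cst QG x ler01); congr Pop; apply/funext => z.
  by rewrite -EFinD addrC subrK.
have := @Pop_ge _ _ _ QG (fun y => (1 - miss A n y)%:E) x y miss0.
rewrite PopR_missE (PopRE x miss0 miss1) -EFinM -EFinD lee_fin => H [E].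
have : 0 < Pmat Gamma x y * (1 - miss A n y) by rewrite mulr_gt0// subr_gt0.
lra.
Qed.

(** Strictness travels backwards along a path of positive transitions ending in [A]. *)
Lemma miss_lt1 A x : jump_irreducible Gamma -> A !=set0 -> exists n, miss A n x < 1.
Proof.
move=> irr [z Az].
have : exists n, miss A n z < 1 by exists 0%N; rewrite miss_in.
elim: {x z Az}(irr x z) => [x y Pxy [n yn]|//|x y z _ IHx _ IHy /IHy/IHx//].
by exists n.+1; exact: miss_lt1_step yn.
Qed.

Lemma potential_bounded A f (b a eps : R) : jump_irreducible Gamma -> A !=set0 ->
  inDomP Gamma f -> (forall x, f x <= b) -> finite_set (sublevel f a) -> 0 < eps ->
  (forall x, ~ sublevel f a x -> gen Gamma f x <= - eps) ->
  exists2 C : R, 0 < C & forall x, ~ A x -> (potential Gamma A x <= C%:E)%E.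
Proof.
move=> irr A0 fD fb finF eps0 fgen.
have f0 x : 0 <= f x by case: fD.
have /choice[m mP] : forall x, exists k, miss A k x < 1.
  by move=> x; exact: miss_lt1.
(* The sublevel set is finite and [miss] decreases in [n], so one depth [N] serves all its
   points. *)
have [M _ MP] := finite_set_bounded (fun x => (m x)%:R : R) finF.
pose N := `|Num.ceil M|%N.
have missN x : sublevel f a x -> miss A N x < 1.
  move=> Fx; apply: le_lt_trans (mP x); apply: miss_mono.
  rewrite -(ler_nat R) (le_trans (MP _ Fx))//.
  rewrite /N natr_absz (le_trans (ceil_ge _))// ler_int ler_norm//.
pose u x := f x / eps.
have u0 x : 0 <= u x by rewrite divr_ge0// ltW.
have ub x : u x <= b / eps by rewrite ler_pM2r ?invr_gt0.
(* On the sublevel set the drift of [u] is unknown; [C] is so large that [C (1 - miss)] pays for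
   [P u] and the holding time. *)
have [C C0 CP] := finite_set_bounded
  (fun x => (PopR u x + (gamma Gamma x)^-1) / (1 - miss A N x)) finF.
pose g x := u x + C * miss A N x.
have g0 x : 0 <= g x by rewrite addr_ge0// mulr_ge0// miss_ge0.
have b0 : 0 <= b / eps.
  by case: A0 => z _; exact: le_trans (u0 z) (ub z).
exists (b / eps + C + 1); first by rewrite ltr_wpDl// addr_ge0.
move=> x Ax; apply: (@le_trans _ _ (g x)%:E); last first.
  rewrite lee_fin /g -addrA lerD//.
  by rewrite (@le_trans _ _ C)// ?lerDl// ler_piMr// miss_le1.
apply: (@potential_le _ _ _ QG A (fun y => (g y)%:E)) => // {Ax}x Ax.
have -> : Pop Gamma (fun y => (g y)%:E) x =
    (PopR u x + C * PopR (miss A N) x)%:E.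
  transitivity (Pop Gamma (fun y => (u y)%:E + C%:E * (miss A N y)%:E)%E x) => //.
  rewrite PopD//; last by move=> y; rewrite -EFinM lee_fin mulr_ge0// miss_ge0.
  rewrite (PopRE x u0 ub) PopZ// => [|y]; last by rewrite lee_fin miss_ge0.
  by rewrite PopR_missE.
rewrite -EFinD lee_fin /g.
have miss2 := @PopR_miss_le A N x Ax.
have miss1 := miss_le1 A N x.
have [Fx|nFx] := pselect (sublevel f a x).
  have := CP x Fx; rewrite ler_pdivrMr ?subr_gt0 ?missN// => CPx.
  have : C * (PopR (miss A N) x + 1) <= C * (2 * miss A N x) by rewrite ler_wpM2l.
  have := u0 x; lra.
have [p pE pgen] := inDomP_Pop QG x fD.
have uE : PopR u x = p / eps.
  apply: EFin_inj; rewrite -(PopRE x u0 ub) mulrC EFinM -pE -PopZ//.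
  - by congr Pop; apply/funext => y; rewrite /u mulrC EFinM.
  - by rewrite invr_ge0 ltW.
have g_gt0 := gamma_gt0 QG x.
(* Off the sublevel set [u] is a supersolution by itself, and the [miss] term does not grow, as
   [P V <= 2 V - 1 <= V]. *)
have : p / eps + (gamma Gamma x)^-1 <= u x.
  have : p - f x <= - eps / gamma Gamma x by rewrite ler_pdivlMr// mulrC -pgen fgen.
  have -> : p / eps + (gamma Gamma x)^-1 = (p + eps / gamma Gamma x) / eps.
    by rewrite mulrDl [eps / _]mulrC mulfK// gt_eqF.
  by rewrite mulNr ler_pM2r ?invr_gt0//; lra.
have : C * PopR (miss A N) x <= C * miss A N x by rewrite ler_wpM2l//; lra.
rewrite uE; lra.
Qed.

Lemma potential_lyapunov z (C : R) : infinite_set [set: X] ->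
  (forall x, x != z -> (potential Gamma [set z] x <= C%:E)%E) ->
  exists (f : X -> R) (b a eps : R),
    inDomP Gamma f /\ ereal_sup (range (fun x => (f x)%:E)) = b%:E /\
    0 < a < b /\ finite_set (sublevel f a) /\ 0 < eps /\
    (forall x, ~ sublevel f a x -> gen Gamma f x <= - eps).
Proof.
move=> infX CP; pose p x := fine (potential Gamma [set z] x).
have p0 x : 0 <= p x by rewrite fine_ge0// potential_ge0.
have pE x : x != z -> potential Gamma [set z] x = (p x)%:E.
  move=> xz; rewrite /p fineK// ge0_fin_numE ?potential_ge0//.
  by rewrite (le_lt_trans (CP _ xz)) ?ltry.
(* The added 1 keeps [f] above 1/2 off [z]; it cancels in [P f - f], up to a loss at [z] of the
   right sign. *)
pose f x := if x == z then 0 else p x + 1.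
have [w wz] : exists w, w != z.
  apply: contrapT => H; apply: infX; apply: sub_finite_set (finite_set1 z) => y _.
  by apply: contrapT => /eqP yz; apply: H; exists y.
have C0 : 0 <= C by rewrite -lee_fin (le_trans _ (CP w wz)) ?potential_ge0.
have f0 x : 0 <= f x by rewrite /f; case: ifP => // _; rewrite addr_ge0.
have fC x : f x <= C + 1.
  rewrite /f; case: ifPn => [_|xz]; first by rewrite addr_ge0.
  by rewrite lerD2r -lee_fin -pE// CP.
have fF : sublevel f (1 / 2) `<=` [set z].
  move=> x; rewrite /sublevel/= /f; case: eqP => //= _.
  by have := p0 x => ? ?; exfalso; lra.
have supE : ereal_sup (range (fun x => (f x)%:E)) \is a fin_num.
  rewrite fin_numElt; apply/andP; split.
    apply: lt_le_trans (ereal_sup_ubound (ex_intro2 _ _ z Logic.I erefl)).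
    by rewrite ltNyr.
  apply: (@le_lt_trans _ _ (C + 1)%:E); last by rewrite ltry.
  by apply: ge_ereal_sup => _ [x _ <-]; rewrite lee_fin.
exists f, (fine (ereal_sup (range (fun x => (f x)%:E)))), (1 / 2), 1.
have fD : inDomP Gamma f.
  split=> // x; under eq_esum do rewrite ger0_norm//.
  rewrite -(Pop_gamma QG x f0) (PopRE x f0 fC) -EFinM ltry//.
split=> //; split; first by rewrite fineK.
split.
  rewrite divr_gt0//= -lte_fin fineK//.
  apply: lt_le_trans (ereal_sup_ubound (ex_intro2 _ _ w Logic.I erefl)).
  by rewrite lte_fin /f (negPf wz); have := p0 w => ?; lra.
split; first exact: sub_finite_set fF (finite_set1 z).
split=> // x nFx.
have xz : x != z.
  by apply/eqP => xz; apply: nFx; rewrite /sublevel/= /f xz eqxx divr_ge0.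
have [q qE ->] := inDomP_Pop QG x fD.
(* [f] is at most the killed potential plus 1, so [potentialE] yields [P f <= f - 1 / gamma], whence
   [eps = 1]. *)
have : (q%:E <= Pop Gamma (kill [set z] (potential Gamma [set z])) x + 1%:E)%E.
  rewrite -qE -(Pop_cst QG x ler01) -PopD//; last first.
    by move=> y; apply: kill_ge0 => t; exact: potential_ge0.
  apply: le_Pop => // y; rewrite /kill /f; case: eqP => [->|/eqP yz].
    by rewrite mem_set// add0e lee_fin.
  by rewrite memNset; [rewrite pE|exact/eqP].
have := potentialE QG [set z] x; rewrite pE//.
have := @Pop_ge0 _ _ _ QG (kill [set z] (potential Gamma [set z])) x.
move=> /(_ (fun y => kill_ge0 _ _ (potential_ge0 QG [set z]))).
case: (Pop _ _ _) => [v| |]//= _; rewrite -!EFinD.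
move=> [pv]; rewrite lee_fin => qv.
have g_gt0 := gamma_gt0 QG x.
rewrite mulrC -ler_pdivlMr// mulN1r /f (negPf xz); lra.
Qed.

End lyapunov_bounded.

(** * Non-implosion *)

Lemma powR_subr1 {R : realType} (x r : R) : 0 < x -> x `^ r = x * x `^ (r - 1).
Proof.
move=> x0; rewrite -{2}(powRr1 (ltW x0)) -powRD; first by rewrite addrC subrK.
by apply/implyP => _; rewrite gt_eqF.
Qed.

(** Young's inequality with exponents [1 / s] and [1 / (1 - s)]. *)
Lemma powR_amgm {R : realType} (s u v : R) : 0 < s -> s < 1 -> 0 <= u -> 0 <= v ->
  u `^ s * v `^ (1 - s) <= s * u + (1 - s) * v.
Proof.
move=> s0 s1 u0 v0; have t0 : 0 < 1 - s by rewrite subr_gt0.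
have := @conjugate_powR _ (u `^ s) (v `^ (1 - s)) s^-1 (1 - s)^-1.
rewrite !powR_ge0 !invr_gt0 !invrK s0 t0 -!powRrM !mulfV ?gt_eqF// !powRr1//.
by rewrite [u * s]mulrC [v * _]mulrC; apply => //; rewrite addrC subrK.
Qed.

(* The right-hand side is the tangent plane at [(u0, v0)] of the left-hand side,
   which is concave in [(u, v)]. *)
Lemma powR_tangent {R : realType} (s u v u0 v0 : R) : 0 < s -> s < 1 ->
  0 <= u -> 0 <= v -> 0 < u0 -> 0 < v0 ->
  u `^ s * v `^ (1 - s) <=
  u0 `^ s * v0 `^ (1 - s) * (s / u0 * u + (1 - s) / v0 * v).
Proof.
move=> s0 s1 u_ge0 v_ge0 u0_gt0 v0_gt0.
have ge0 : 0 <= u0 `^ s * v0 `^ (1 - s) by rewrite mulr_ge0// powR_ge0.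
have un : 0 <= u / u0 by rewrite divr_ge0// ltW.
have vn : 0 <= v / v0 by rewrite divr_ge0// ltW.
have := ler_wpM2l ge0 (powR_amgm s0 s1 un vn).
have -> : u0 `^ s * v0 `^ (1 - s) * ((u / u0) `^ s * (v / v0) `^ (1 - s)) =
    u `^ s * v `^ (1 - s).
  rewrite mulrACA -!powRM ?(ltW u0_gt0) ?(ltW v0_gt0)//.
  by rewrite mulrC [u0 * _]mulrC [v0 * _]mulrC !divfK ?gt_eqF// mulrC.
by move/le_trans; apply; rewrite le_eqVlt; apply/orP; left; apply/eqP; ring.
Qed.

Section nonimplosion.
Context {R : realType} {X : countType}.
Variable Gamma : X -> X -> R.
Hypothesis QG : Qmatrix Gamma.
Variables (f : X -> R) (a c eps r K : R).
Hypothesis fD : inDomP Gamma f.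
Hypothesis a_gt0 : 0 < a.
Hypothesis c_gt0 : 0 < c.
Hypothesis eps_gt0 : 0 < eps.
Hypothesis r_gt1 : 1 < r.
Hypothesis frD : inDomP Gamma (fun x => f x `^ r).
Hypothesis genf : forall x, ~ sublevel f a x -> - eps <= gen Gamma f x.
Hypothesis genfr : forall x, ~ sublevel f a x ->
  gen Gamma (fun y => f y `^ r) x <= c * f x `^ (r - 1).
Local Notation F := (sublevel f a).
Hypothesis K_ge0 : 0 <= K.
Hypothesis potK : forall x, ~ F x -> (potential Gamma F x <= K%:E)%E.

Let p x := fine (potential Gamma F x).

Let pE x : ~ F x -> potential Gamma F x = (p x)%:E.
Proof.
move=> Fx; rewrite /p fineK// ge0_fin_numE ?potential_ge0//.
by rewrite (le_lt_trans (potK Fx)) ?ltry.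
Qed.

Let p_ge0 x : 0 <= p x. Proof. by rewrite fine_ge0// potential_ge0. Qed.

(** The value 0 on [F] discards the holding time that [potential] counts there; the bound by [K]
    then holds everywhere. *)
Let h x := if x \in F then 0 else p x.

Let h_ge0 x : 0 <= h x. Proof. by rewrite /h; case: ifP => // _; exact: p_ge0. Qed.

Let h_leK x : h x <= K.
Proof.
rewrite /h; case: ifPn => //; rewrite notin_setE => Fx.
by rewrite -lee_fin -pE// potK.
Qed.

Let hE : kill F (potential Gamma F) = fun x => (h x)%:E.
Proof.
apply/funext => x; rewrite /kill /h; case: ifPn => //.
by rewrite notin_setE => /pE.
Qed.

Let Poph x : ~ F x -> Pop Gamma (fun y => (h y)%:E) x = (h x - (gamma Gamma x)^-1)%:E.
Proof.
move=> Fx; have := potentialE QG F x; rewrite hE (PopRE QG x h_ge0 h_leK) pE//.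
rewrite -EFinD => -[px]; congr (_%:E).
have -> : h x = p x by rewrite /h memNset.
by rewrite px addrC addKr.
Qed.

(* U = (f ^ r + C) ^ s (1 + h) ^ (1 - s) with 1 / r < s < 1: the decrease of 1 + h
   absorbs the growth of f ^ r + C, and U dominates f ^ (r s). *)
Lemma superlinear_supersolution : exists (q : R) (U : X -> R),
  [/\ 1 < q, (forall x, f x `^ q <= U x) &
    forall x, ~ F x -> (Pop Gamma (fun y => (U y)%:E) x <= (U x)%:E)%E].
Proof.
have r_gt0 : 0 < r by apply: lt_trans r_gt1.
(* [s] is the midpoint of [1 / r] and 1. As [1 + h <= 1 + K], the decrease [rho] of [1 + h] is at
   least [lam rho (1 + h)]. *)
pose s := (1 + r^-1) / 2; pose lam := (1 + K)^-1.
have rV : r^-1 < 1 by rewrite invf_lt1.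
have rV0 : 0 < r^-1 by rewrite invr_gt0.
have s0 : 0 < s by rewrite /s; lra.
have s1 : s < 1 by rewrite /s; lra.
have rs1 : 1 < r * s.
  by rewrite /s mulrA mulrDr mulr1 mulfV ?gt_eqF//; move: r_gt1; lra.
have K1 : 0 < 1 + K by apply: ltr_wpDr.
have lam0 : 0 < lam by rewrite invr_gt0.
(* Chosen so that [s eta = (1 - s) lam]: relative growth and decrease balance in the weighted
   mean. *)
pose eta := (1 - s) * lam / s.
have eta0 : 0 < eta by rewrite divr_gt0// mulr_gt0// subr_gt0.
(* This gives [c f^(r - 1) <= eta (f^r + C)]: the term [f^r] suffices where [f >= c / eta], and
   [eta C = c (c / eta)^(r - 1)] elsewhere. *)
pose C := (c / eta) `^ r.
have C0 : 0 < C by rewrite powR_gt0// divr_gt0.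
have f0 x : 0 <= f x by case: fD.
pose g x := f x `^ r + C; pose w x := 1 + h x.
have g0 x : 0 < g x by rewrite ltr_wpDl// powR_ge0.
have w0 x : 0 < w x by rewrite ltr_wpDr.
pose U x := g x `^ s * w x `^ (1 - s).
exists (r * s), U; split=> // [x|x Fx].
  rewrite powRrM /U -[leLHS]mulr1; apply: ler_pM; rewrite ?powR_ge0//.
    by apply: ge0_ler_powR; rewrite ?nnegrE ?powR_ge0 ?(ltW (g0 x)) ?(ltW s0)// lerDl ltW.
  rewrite -[leLHS](powRr0 (w x)); apply: ler_powR; first by rewrite lerDl.
  by rewrite subr_ge0 ltW.
have fx : 0 < f x.
  by rewrite (lt_trans a_gt0)// ltNge; apply/negP.
have gg : c * f x `^ (r - 1) <= eta * g x.
  have [cf|fc] := leP (c / eta) (f x).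
    rewrite /g mulrDr ler_wpDr//; first exact: mulr_ge0 (ltW eta0) (ltW C0).
    rewrite (powR_subr1 r fx).
    by rewrite mulrA ler_wpM2r ?powR_ge0// mulrC -ler_pdivrMr.
  rewrite /g mulrDr ler_wpDl//; first exact: mulr_ge0 (ltW eta0) (powR_ge0 _ _).
  have ce : 0 < c / eta by rewrite divr_gt0.
  rewrite {1}/C (powR_subr1 r ce).
  rewrite mulrA [eta * _]mulrC divfK ?gt_eqF// ler_wpM2l ?(ltW c_gt0)//.
  by apply: ge0_ler_powR; rewrite ?nnegrE ?(ltW fx) ?(ltW fc) ?(ltW ce)// subr_ge0 ltW.
have ga0 := gamma_gt0 QG x; set rho := (gamma Gamma x)^-1.
have rho0 : 0 < rho by rewrite invr_gt0.
have [pr prE pgen] := inDomP_Pop QG x frD.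
have Pg : (Pop Gamma (fun y => (g y)%:E) x <= (g x * (1 + eta * rho))%:E)%E.
  rewrite (_ : Pop _ _ x = (pr + C)%:E) ?lee_fin; last first.
    rewrite EFinD -prE -(Pop_cst QG x (ltW C0)) -PopD// => y.
      by rewrite lee_fin powR_ge0.
    by rewrite lee_fin ltW.
  have : pr - f x `^ r <= c * f x `^ (r - 1) * rho.
    by rewrite ler_pdivlMr// mulrC -pgen genfr.
  have : c * f x `^ (r - 1) * rho <= eta * g x * rho by rewrite ler_pM2r.
  have -> : g x * (1 + eta * rho) = g x + eta * g x * rho by ring.
  have : g x = f x `^ r + C by [].
  lra.
have Pw : (Pop Gamma (fun y => (w y)%:E) x <= (w x * (1 - lam * rho))%:E)%E.
  rewrite (_ : Pop _ _ x = (w x - rho)%:E) ?lee_fin; last first.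
    transitivity (Pop Gamma (fun y => 1%:E + (h y)%:E)%E x) => //.
    by rewrite PopD// (Pop_cst QG x ler01) Poph// -EFinD addrA.
  rewrite mulrBr mulr1 lerD2l lerN2 mulrA ler_piMl ?(ltW rho0)//.
  by rewrite ler_pdivrMr// mul1r lerD2l.
have A0 : 0 <= s / g x by rewrite divr_ge0// ltW.
have B0 : 0 <= (1 - s) / w x by rewrite divr_ge0 ?(ltW (w0 x))// subr_ge0 ltW.
have U0 : 0 <= U x by rewrite mulr_ge0// powR_ge0.
(* By the choice of [eta], the factor of [U x] equals 1. *)
apply: (@le_trans _ _ (U x * (s / g x * (g x * (1 + eta * rho)) +
    (1 - s) / w x * (w x * (1 - lam * rho))))%:E); last first.
  rewrite !mulrA !divfK ?gt_eqF// lee_fin ler_piMr//.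
  have -> : s * (1 + eta * rho) = s + (1 - s) * lam * rho.
    by rewrite mulrDr mulr1 mulrA [s * eta]mulrC divfK ?gt_eqF.
  lra.
(* The tangent plane at [(g x, w x)] is linear, so [P] acts on [g] and [w] separately. *)
apply: (@le_trans _ _ (Pop Gamma (fun y => (U x)%:E *
    ((s / g x)%:E * (g y)%:E + ((1 - s) / w x)%:E * (w y)%:E))%E x)).
  apply: le_Pop => // y.
  exact: powR_tangent s0 s1 (ltW (g0 y)) (ltW (w0 y)) (g0 x) (w0 x).
have g0E y : (0 <= (g y)%:E)%E by rewrite lee_fin ltW.
have w0E y : (0 <= (w y)%:E)%E by rewrite lee_fin ltW.
rewrite PopZ// => [|y]; last by rewrite adde_ge0// mule_ge0// lee_fin.
rewrite PopD// => [|y|y]; last 2 first.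
- by rewrite mule_ge0// lee_fin.
- by rewrite mule_ge0// lee_fin.
rewrite !PopZ//.
rewrite [leRHS]EFinM lee_wpmul2l ?lee_fin// [leRHS]EFinD; apply: leeD.
- by rewrite [leRHS]EFinM lee_wpmul2l ?lee_fin.
- by rewrite [leRHS]EFinM lee_wpmul2l ?lee_fin.
Qed.

(** Optional stopping as an induction on [n]: [f <= a + eps h + del U] holds up to a constant times
    the probability of avoiding [F] for [n] steps. Then [n] tends to infinity, and afterwards [del]
    to 0. *)
Lemma bounded_potential_bound :
  (forall x, ~ F x -> forall e : R, 0 < e ->
    exists n, (Qiter Gamma F n (fun=> 1%:E) x <= e%:E)%E) ->
  forall x, ~ F x -> f x <= a + eps * K.
Proof.
move=> hit x Fx.
have f0 y : 0 <= f y by case: fD.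
have [q [U [q1 fU PU]]] := superlinear_supersolution.
have U0 y : 0 <= U y := le_trans (powR_ge0 _ _) (fU y).
have main (del : R) : 0 < del -> exists2 C : R, 0 < C & forall n y, ~ F y ->
   ((f y)%:E <= (a + eps * h y + del * U y)%:E +
      C%:E * Qiter Gamma F n (fun=> 1%:E) y)%E.
  (* Above the threshold [C], [f <= del f^q <= del U]. *)
  move=> del0; pose C := (del^-1) `^ (q - 1)^-1.
  have C0 : 0 < C by rewrite powR_gt0// invr_gt0.
  have q0 : 0 < q - 1 by rewrite subr_gt0.
  exists C => //; elim=> [|n IH] y Fy.
    rewrite /= mule1 -EFinD lee_fin.
    suff : f y <= del * U y + C.
      by have := mulr_ge0 (ltW eps_gt0) (h_ge0 y); move: a_gt0; lra.
    have [fC|Cf] := leP (f y) C.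
      by rewrite ler_wpDl// mulr_ge0// ltW.
    have fy : 0 < f y by apply: lt_trans Cf.
    rewrite ler_wpDr ?(ltW C0)//.
    apply: (@le_trans _ _ (del * f y `^ q)); last by rewrite ler_pM2l.
    rewrite (powR_subr1 q fy) mulrCA ler_peMr// ?(ltW fy)// mulrC -ler_pdivrMr// div1r.
    have -> : del^-1 = C `^ (q - 1).
      by rewrite /C -powRrM mulVf ?gt_eqF// powRr1// invr_ge0 ltW.
    by apply: ge0_ler_powR; rewrite ?nnegrE ?(ltW q0) ?(ltW C0) ?(ltW fy) ?(ltW Cf).
  have ga0 := gamma_gt0 QG y; set rho := (gamma Gamma y)^-1.
  have [pf pfE pgen] := inDomP_Pop QG y fD.
  have f_le : f y <= pf + eps * rho.
    have : - (eps * rho) <= pf - f y.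
      by rewrite -mulNr ler_pdivrMr// mulrC -pgen genf.
    lra.
  pose e := kill F (Qiter Gamma F n (fun=> 1%:E)).
  have e0 z : (0 <= e z)%E.
    by apply: kill_ge0 => t; apply: Qiter_ge0 => // _; rewrite lee_fin.
  (* The induction hypothesis under [P]. The [- eps rho] coming from [Poph] cancels the loss in
     [f <= P f + eps rho]. *)
  have le_pf : (pf%:E <= a%:E + (eps%:E * (h y - rho)%:E +
      (del%:E * (U y)%:E + C%:E * Pop Gamma e y)))%E.
    rewrite -pfE.
    apply: (@le_trans _ _ (Pop Gamma (fun z => a%:E + (eps%:E * (h z)%:E +
      (del%:E * (U z)%:E + C%:E * e z)))%E y)).
      (* On [F] the killed term is 0 and [a] alone bounds [f]. *)
      apply: le_Pop => // z; rewrite /e /kill; case: ifPn => [/set_mem Fz|].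
        rewrite mule0 adde0 -!EFinM -!EFinD lee_fin.
        have : 0 <= eps * h z by rewrite mulr_ge0// ltW.
        have : 0 <= del * U z by rewrite mulr_ge0// ltW.
        by move: Fz; rewrite /sublevel/=; lra.
      rewrite notin_setE => /IH; rewrite -!EFinM !addeA -!EFinD; exact.
    have a0E (z : X) : (0 <= a%:E)%E by rewrite lee_fin ltW.
    have h0E z : (0 <= eps%:E * (h z)%:E)%E by rewrite -EFinM lee_fin mulr_ge0// ltW.
    have U0E z : (0 <= del%:E * (U z)%:E)%E by rewrite -EFinM lee_fin mulr_ge0// ltW.
    have C0E z : (0 <= C%:E * e z)%E by rewrite mule_ge0// lee_fin ltW.
    rewrite PopD//; last by move=> z; rewrite !adde_ge0.
    rewrite PopD//; last by move=> z; rewrite !adde_ge0.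
    rewrite PopD// (PopZ QG y (ltW eps_gt0))// (PopZ QG y (ltW del0))//.
    rewrite (PopZ QG y (ltW C0))// Pop_cst ?(ltW a_gt0)// Poph//.
    rewrite !leeD2l// leeD2r// lee_wpmul2l ?lee_fin ?(ltW del0)//; exact: PU.
  apply: (@le_trans _ _ (pf%:E + (eps * rho)%:E)%E); first by rewrite -EFinD lee_fin.
  apply: (@le_trans _ _ (a%:E + (eps%:E * (h y - rho)%:E +
      (del%:E * (U y)%:E + C%:E * Pop Gamma e y)) + (eps * rho)%:E)%E).
    by rewrite leeD2r.
  rewrite /= -/e -!EFinM !addeA -!EFinD addeAC -EFinD leeD2r// lee_fin.
  by rewrite mulrBr; lra.
have step (del : R) : 0 < del -> f x <= a + eps * h x + del * U x.
  move=> del0; have [C C0 CP] := main _ del0.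
  apply/ler_addgt0Pr => e e0.
  have [n nP] := hit x Fx (e / C) (divr_gt0 e0 C0).
  rewrite -lee_fin; apply: le_trans (CP n x Fx) _.
  rewrite [leRHS]EFinD leeD2l//.
  have -> : (e%:E = C%:E * (e / C)%:E)%E by rewrite -EFinM mulrC divfK ?gt_eqF.
  by rewrite lee_wpmul2l ?lee_fin ?(ltW C0).
apply: (@le_trans _ _ (a + eps * h x)); last by rewrite lerD2l ler_wpM2l ?(ltW eps_gt0).
apply/ler_addgt0Pr => e e0.
apply: le_trans (step (e / (U x + 1)) _) _.
  by rewrite divr_gt0// ltr_wpDl.
rewrite lerD2l mulrAC ler_pdivrMr ?ltr_wpDl// ler_pM2l// lerDl//.
Qed.

End nonimplosion.

(** * Path events and killed iterates *)

Section path_laws.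
Context {R : realType} {X : countType}.
Context {d : measure_display} {Omega : measurableType d}.
Variable Gamma : X -> X -> R.
Hypothesis QG : Qmatrix Gamma.
Variables (Px : X -> probability Omega R) (xi : nat -> Omega -> X).
Variable hold : nat -> Omega -> R.
Hypothesis CR : CTMC_realization Gamma Px xi hold.
Implicit Types (A B : set X) (x y : X) (m n k : nat) (s : nat -> X).

Definition path_prob x n s : R :=
  (if s 0%N == x then 1 else 0) * \prod_(k < n) Pmat Gamma (s k) (s k.+1).

Definition path_event n s : set Omega :=
  [set w | forall k, (k <= n)%N -> xi k w = s k].

Definition upd s n y : nat -> X := fun k => if k == n then y else s k.

(** Step [m] is left untested to match [Qiter], started at step [m]. *)
Definition avoid_after A m n : set Omega :=
  [set w | forall k, (m < k <= n)%N -> ~ A (xi k w)].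

Lemma path_prob_ge0 x n s : 0 <= path_prob x n s.
Proof.
rewrite /path_prob mulr_ge0//; first by case: ifP.
by apply: prodr_ge0 => k _; exact: Pmat_ge0.
Qed.

Lemma path_probS x n s y :
  path_prob x n.+1 (upd s n.+1 y) = path_prob x n s * Pmat Gamma (s n) y.
Proof.
rewrite /path_prob big_ord_recr/= -mulrA /upd eqxx.
rewrite (ltn_eqF (ltnSn n)); congr (_ * (_ * _)).
apply: eq_bigr => k _; rewrite ltn_eqF 1?ltnS//; last exact: ltnW.
by rewrite eqSS ltn_eqF.
Qed.

Lemma path_eventS n s y :
  path_event n.+1 (upd s n.+1 y) = path_event n s `&` xi n.+1 @^-1` [set y].
Proof.
apply/seteqP; split=> w /=.
  move=> H; split=> [k kn|]; last by rewrite H// /upd eqxx.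
  by rewrite H 1?leqW// /upd ltn_eqF// ltnS.
move=> [H Hy] k; rewrite leq_eqVlt /upd => /predU1P[->|kn]; first by rewrite eqxx.
by rewrite ltn_eqF// H.
Qed.

Lemma measurable_xi n B : measurable (xi n @^-1` B).
Proof.
have -> : xi n @^-1` B = \bigcup_(y in B) xi n @^-1` [set y].
  apply/seteqP; split=> w /=; first by move=> Bw; exists (xi n w).
  by move=> [y By /= ->].
by apply: measurable_countType_bigcup => y _; case: CR => + _; exact.
Qed.

Lemma measurable_path_event n s : measurable (path_event n s).
Proof.
have -> : path_event n s = \bigcap_(k in [set k | (k <= n)%N]) xi k @^-1` [set s k].
  by apply/seteqP; split=> w H k /H.
by apply: bigcap_measurableType => k _; exact: measurable_xi.
Qed.

Lemma measurable_avoid_after A m n : measurable (avoid_after A m n).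
Proof.
have -> : avoid_after A m n =
    \bigcap_(k in [set k | (m < k <= n)%N]) xi k @^-1` (~` A).
  by apply/seteqP; split=> w H k /H.
by apply: bigcap_measurableType => k _; exact: measurable_xi.
Qed.

(** * Set functions with a weighted Markov path law *)

Section avoidance.
Variables (nu : set Omega -> \bar R) (x : X) (n : nat) (phi : X -> \bar R).
Hypothesis nu0 : nu set0 = 0%E.
Hypothesis nu_ge0 : forall E, (0 <= nu E)%E.
Hypothesis nu_add : forall E : nat -> set Omega, (forall i, measurable (E i)) ->
  trivIset [set: nat] E -> nu (\bigcup_i E i) = (\sum_(i <oo) nu (E i))%E.
Hypothesis phi_ge0 : forall y, (0 <= phi y)%E.
Hypothesis nu_path : forall s,
  nu (path_event n s) = ((path_prob x n s)%:E * phi (s n))%E.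

(** Splitting by the state at step [m + 1] and summing over it is one application of [P] killed on
    [A]. [nu] will be a probability, its restriction to positive holding times, or the integral of a
    holding time. *)
Lemma path_avoid A j m s : (m + j)%N = n ->
  nu (path_event m s `&` avoid_after A m n) =
  ((path_prob x m s)%:E * Qiter Gamma A j phi (s m))%E.
Proof.
elim: j m s => [|j IH] m s.
  rewrite addn0 => -> /=; rewrite -nu_path; congr nu.
  apply/seteqP; split=> w; first by case.
  by move=> H; split=> // k; rewrite ltnNge andNb.
move=> mjn.
have -> : path_event m s `&` avoid_after A m n =
    \bigcup_(y in ~` A) (path_event m.+1 (upd s m.+1 y) `&` avoid_after A m.+1 n).
  apply/seteqP; split=> w.
    move=> [Hp Ha]; exists (xi m.+1 w).
      by apply: Ha; rewrite ltnSn/= -mjn addnS ltnS leq_addr.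
    split; first by rewrite path_eventS.
    by move=> k /andP[mk kn]; apply: Ha; rewrite kn andbT; exact: ltnW.
  move=> [y Ay []]; rewrite path_eventS => -[Hp xy] Ha; split=> // k /andP[].
  rewrite leq_eqVlt => /predU1P[<- _|mk kn]; first by rewrite (_ : xi _ _ = y).
  by apply: Ha; rewrite mk.
rewrite (additive_countType_bigcup nu0 nu_ge0 nu_add); last 2 first.
- move=> y _; apply: measurableI; first exact: measurable_path_event.
  exact: measurable_avoid_after.
- move=> y z _ _ [w [[+ _] [+ _]]].
  by rewrite !path_eventS => -[_ <-] [_ <-].
rewrite /= /Pop -esumZl//; last 2 first.
- exact: path_prob_ge0.
- move=> y; rewrite mule_ge0 ?lee_fin ?Pmat_ge0// kill_ge0// => z.
  exact: Qiter_ge0.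
rewrite [LHS]esum_mkcond; apply: eq_esum => y _; rewrite in_setC /kill.
case: ifPn => /= [yA|]; first by rewrite (negPf yA) IH ?addSnnS// path_probS
  /upd eqxx EFinM muleA.
by rewrite negbK => ->; rewrite !mule0.
Qed.

(** Starting points other than [x] have zero path probability. [B] will be the whole space or the
    complement of [A]. *)
Lemma avoid_from A B : B x ->
  nu (xi 0%N @^-1` B `&` avoid_after A 0 n) = Qiter Gamma A n phi x.
Proof.
move=> Bx.
have -> : xi 0%N @^-1` B `&` avoid_after A 0 n =
    \bigcup_(y in B) (path_event 0 (fun=> y) `&` avoid_after A 0 n).
  apply/seteqP; split=> w.
    move=> [Bw Ha]; exists (xi 0%N w) => //; split=> // k.
    by rewrite leqn0 => /eqP ->.
  by move=> [y By [H Ha]]; split=> //=; rewrite H.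
rewrite (additive_countType_bigcup nu0 nu_ge0 nu_add); last 2 first.
- move=> y _; apply: measurableI; first exact: measurable_path_event.
  exact: measurable_avoid_after.
- by move=> y z _ _ [w [[/(_ 0%N erefl) <- _] [/(_ 0%N erefl) <- _]]].
rewrite -[RHS](@esum_set1 _ _ x (fun=> Qiter Gamma A n phi x)); last exact: Qiter_ge0.
rewrite [RHS]esum_mkcond [LHS]esum_mkcond; apply: eq_esum => y _.
rewrite (path_avoid _ (fun=> y) (add0n n)) /path_prob big_ord0 mulr1.
have [->|yx] := eqVneq y x; first by rewrite !mem_set// mul1e.
rewrite [in RHS]memNset; last exact/eqP.
by case: ifP => // _; rewrite mul0e.
Qed.

End avoidance.

End path_laws.

(** * Holding times *)

Lemma integral_expR_tail {R : realType} (g c : R) : 0 < g -> 0 <= c ->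
  (\int[lebesgue_measure]_(t in `[0%R, +oo[) (c * expR (- g * t))%:E = (c / g)%:E)%E.
Proof.
move=> g0 c0.
have cg : 0 <= c / g by rewrite divr_ge0// ltW.
rewrite -[RHS]mule1 -(integral_exponential_pdf g0) -ge0_integralZl_EFin//; last 2 first.
- by move=> t _; rewrite lee_fin exponential_pdf_ge0// ltW.
- by apply/measurable_EFinP; exact: measurable_exponential_pdf.
rewrite [LHS]integral_mkcond; apply: eq_integral => t _.
rewrite patchE /exponential_pdf patchE; case: ifP => _; last by rewrite mule0.
by rewrite -EFinM mulrA divfK// gt_eqF.
Qed.

Section holding_times.
Context {R : realType} {X : countType}.
Context {d : measure_display} {Omega : measurableType d}.
Variable Gamma : X -> X -> R.
Hypothesis QG : Qmatrix Gamma.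
Variables (Px : X -> probability Omega R) (xi : nat -> Omega -> X).
Variable hold : nat -> Omega -> R.
Hypothesis CR : CTMC_realization Gamma Px xi hold.
Implicit Types (A B : set X) (x y : X) (m n k : nat) (s : nat -> X).
Local Notation path_event := (path_event xi).
Local Notation path_prob := (path_prob Gamma).
Local Notation avoid_after := (avoid_after xi).

Definition pos_holds n : set Omega := [set w | forall k, (k < n)%N -> 0 < hold k w].

Lemma measurable_hold n : measurable_fun [set: Omega] (hold n).
Proof. by case: CR => _ [+ _]; exact. Qed.

Lemma measurable_hold_gt n (t : R) : measurable [set w | t < hold n w].
Proof.
rewrite (_ : [set w | t < hold n w] = setT `&` hold n @^-1` `]t, +oo[%classic).
  by apply: measurable_hold => //; exact: measurable_itv.
by rewrite setTI; apply/seteqP; split=> w; rewrite /= in_itv/= andbT.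
Qed.

Lemma measurable_pos_holds n : measurable (pos_holds n).
Proof.
have -> : pos_holds n = \bigcap_(k in [set k | (k < n)%N]) [set w | 0 < hold k w].
  by apply/seteqP; split=> w H k /H.
by apply: bigcap_measurableType => k _; exact: measurable_hold_gt.
Qed.

Lemma cylinder_prob x n s (t : nat -> R) : (forall k, 0 <= t k) ->
  Px x [set w | (forall k, (k <= n)%N -> xi k w = s k) /\
                (forall k, (k < n)%N -> t k < hold k w)]
  = ((if s 0%N == x then 1 else 0) *
     \prod_(k < n) (Pmat Gamma (s k) (s k.+1) * expR (- gamma Gamma (s k) * t k)))%:E.
Proof. by case: CR => _ [_ +]; exact. Qed.

Lemma path_pos_holds_prob x n s :
  Px x (path_event n s `&` pos_holds n) = (path_prob x n s)%:E.
Proof.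
have := @cylinder_prob x n s (fun=> 0) (fun=> lexx 0); rewrite /path_prob.
under eq_bigr do rewrite mulr0 expR0 mulr1.
exact.
Qed.

(** At [t = 0] the cylinder law weighs paths jointly with positivity of the holding times. These
    weights sum to 1 over all paths, avoidance of the empty set being no restriction. *)
Lemma pos_holds_prob1 x n : Px x (pos_holds n) = 1%E.
Proof.
pose nu E := Px x (E `&` pos_holds n).
have -> : Px x (pos_holds n) =
    nu (xi 0%N @^-1` setT `&` avoid_after set0 0 n).
  congr (Px x _); apply/seteqP; split=> w; last by case.
    by move=> Hw; split=> //; split=> // k _ [].
rewrite (@avoid_from _ _ _ _ _ QG _ _ _ CR nu x n (fun=> 1%:E))//.
- exact: Qiter_set0_cst.
- by rewrite /nu set0I measure0.
- move=> E mE tE; rewrite /nu setI_bigcupl measure_semi_bigcup//.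
  + by move=> i; apply: measurableI => //; exact: measurable_pos_holds.
  + exact: trivIset_setIr.
  + apply: bigcup_measurable => i _; apply: measurableI => //.
    exact: measurable_pos_holds.
- by move=> s; rewrite mule1 -path_pos_holds_prob.
Qed.

Lemma probI_pos_holds x n E : measurable E -> Px x (E `&` pos_holds n) = Px x E.
Proof.
move=> mE; have mH := measurable_pos_holds n.
rewrite [RHS](_ : _ = Px x (E `&` pos_holds n) + Px x (E `\` pos_holds n))%E.
  rewrite [X in (_ + X)%E](_ : _ = 0%E) ?adde0//.
  apply: (@subset_measure0 _ _ _ _ _ (~` pos_holds n)).
  - exact: measurableD.
  - exact: measurableC.
  - by move=> w [].
  - have := probability_setC (Px x) mH; rewrite pos_holds_prob1 subee//; exact.
rewrite addeC -measureDI//.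
Qed.

Lemma path_event_prob x n s : Px x (path_event n s) = (path_prob x n s)%:E.
Proof.
by rewrite -path_pos_holds_prob probI_pos_holds//; exact: (measurable_path_event CR).
Qed.

(** Cylinders of length [n] do not constrain [hold n]; those of length [n + 1], with threshold [t]
    at [n] and 0 before, do, and are summed over the extra state. *)
Lemma path_hold_prob x n s (t : R) : 0 <= t ->
  Px x (path_event n s `&` [set w | t < hold n w]) =
  (path_prob x n s * expR (- gamma Gamma (s n) * t))%:E.
Proof.
move=> t0; pose tt k := if k == n then t else 0.
have tt0 k : 0 <= tt k by rewrite /tt; case: ifP.
pose E y := [set w | (forall k, (k <= n.+1)%N -> xi k w = upd s n.+1 y k) /\
                     (forall k, (k < n.+1)%N -> tt k < hold k w)].
have mE1 : measurable (path_event n s `&` [set w | t < hold n w]).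
  apply: measurableI; first exact: (measurable_path_event CR).
  exact: measurable_hold_gt.
have EE y : E y = path_event n s `&` [set w | t < hold n w] `&` pos_holds n
                    `&` xi n.+1 @^-1` [set y].
  apply/seteqP; split=> w.
    move=> [Hp Ht]; move: (Hp : path_event n.+1 (upd s n.+1 y) w).
    rewrite path_eventS => -[Hn Hy]; do 3?split=> //=.
      by have := Ht n (ltnSn n); rewrite /tt eqxx.
    by move=> k kn; have := Ht k (ltnW kn); rewrite /tt ltn_eqF.
  move=> [[[Hn Ht] Hh] Hy]; split.
    by change (path_event n.+1 (upd s n.+1 y) w); rewrite path_eventS.
  move=> k; rewrite ltnS leq_eqVlt /tt => /predU1P[->|kn]; first by rewrite eqxx.
  by rewrite ltn_eqF//; exact: Hh.
rewrite -(probI_pos_holds x n mE1).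
have -> : path_event n s `&` [set w | t < hold n w] `&` pos_holds n =
    \bigcup_(y in [set: X]) E y.
  apply/seteqP; split=> w; first by move=> Hw; exists (xi n.+1 w) => //; rewrite EE.
  by move=> [y _]; rewrite EE => -[].
rewrite (@additive_countType_bigcup _ _ _ _ (Px x))//; last 3 first.
- by move=> F mF tF; rewrite measure_semi_bigcup//; exact: bigcup_measurable.
- move=> y _; rewrite EE; apply: measurableI; last exact: (measurable_xi CR).
  by apply: measurableI => //; exact: measurable_pos_holds.
- by move=> y z _ _ [w []]; rewrite !EE => -[_ <-] [_ <-].
have -> : (path_prob x n s * expR (- gamma Gamma (s n) * t))%:E =
    ((path_prob x n s * expR (- gamma Gamma (s n) * t))%:E *
      Pop Gamma (fun=> 1%:E) (s n))%E by rewrite Pop_cst// mule1.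
rewrite /Pop -esumZl//; last 2 first.
- by rewrite mulr_ge0 ?expR_ge0// path_prob_ge0.
- by move=> y; rewrite mule_ge0 ?lee_fin ?Pmat_ge0.
apply: eq_esum => y _; rewrite cylinder_prob// mule1 -EFinM; congr (_%:E).
rewrite big_split/= mulrA -[X in X * _ = _]/(path_prob x n.+1 (upd s n.+1 y)).
rewrite path_probS mulrAC; congr (_ * _ * _).
rewrite big_ord_recr/= /tt eqxx big1 ?mul1r => [|k _].
  by rewrite /upd ltn_eqF.
by rewrite ltn_eqF// mulr0 expR0.
Qed.

(* Holding times are positive only almost surely. *)
Definition hold_pos n w : \bar R := (Num.max (hold n w) 0)%:E.

Lemma measurable_hold_pos n : measurable_fun [set: Omega] (hold_pos n).
Proof.
by apply/measurable_EFinP; apply: measurable_maxr => //; exact: measurable_hold.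
Qed.

Lemma hold_pos_ge0 n w : (0 <= hold_pos n w)%E.
Proof. by rewrite lee_fin le_max lexx orbT. Qed.

(** The mean of a nonnegative variable is the integral of its tail, here exponential; the indicator
    of the path event is made part of the variable. *)
Lemma path_hold_integral x n s :
  (\int[Px x]_(w in path_event n s) hold_pos n w =
   (path_prob x n s)%:E * (gamma Gamma (s n))^-1%:E)%E.
Proof.
have mE := measurable_path_event CR n s.
pose f w : R := \1_(path_event n s) w * Num.max (hold n w) 0.
have mf : measurable_fun [set: Omega] f.
  apply: measurable_funM; first exact: measurable_indic.
  by apply: measurable_maxr => //; exact: measurable_hold.
have f0 w : 0 <= f w by rewrite mulr_ge0// le_max lexx orbT.
pose F : {RV (Px x) >-> R} := HB.pack f (isMeasurableFun.Build _ _ _ _ f mf).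
have := @ge0_expectation_ccdf _ _ _ (Px x) F f0.
rewrite expectation_def.
have -> : (\int[Px x]_w (F w)%:E = \int[Px x]_(w in path_event n s) hold_pos n w)%E.
  rewrite [RHS]integral_mkcond; apply: eq_integral => w _.
  rewrite patchE /= /f indicE /hold_pos.
  by case: ifP => _; rewrite ?mul1r ?mul0r.
move=> ->.
rewrite -EFinM -(integral_expR_tail (gamma_gt0 QG (s n)) (path_prob_ge0 QG x n s)).
apply: eq_integral => t /set_mem /=; rewrite in_itv/= andbT => t0.
rewrite -path_hold_prob//; congr (Px x _).
apply/seteqP; split=> w /=; rewrite in_itv/= andbT /f indicE.
  case: (boolP (w \in path_event n s)) => [/set_mem Ew|_]; last first.
    by rewrite mul0r => /(le_lt_trans t0); rewrite ltxx.
  by rewrite mul1r lt_max => /orP[//|/(le_lt_trans t0)]; rewrite ltxx.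
by move=> [Ew tw]; rewrite mem_set// mul1r lt_max tw.
Qed.

Lemma avoid_prob x n A B : B x ->
  Px x (xi 0%N @^-1` B `&` avoid_after A 0 n) = Qiter Gamma A n (fun=> 1%:E) x.
Proof.
move=> Bx; rewrite (@avoid_from _ _ _ _ _ QG _ _ _ CR (Px x) x n (fun=> 1%:E))//.
- by move=> F mF tF; rewrite measure_semi_bigcup//; exact: bigcup_measurable.
- by move=> s; rewrite path_event_prob mule1.
Qed.

Lemma avoid_hold_integral x n A B : B x ->
  (\int[Px x]_(w in xi 0%N @^-1` B `&` avoid_after A 0 n) hold_pos n w =
   Qiter Gamma A n (fun y => (gamma Gamma y)^-1%:E) x)%E.
Proof.
move=> Bx.
rewrite (@avoid_from _ _ _ _ _ QG _ _ _ CR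
  (fun E => \int[Px x]_(w in E) hold_pos n w)%E x n (fun y => (gamma Gamma y)^-1%:E))//.
- exact: integral_set0.
- by move=> E; apply: integral_ge0 => w _; exact: hold_pos_ge0.
- move=> E mE tE; rewrite ge0_integral_bigcup//.
  + by apply: measurable_funTS; exact: measurable_hold_pos.
  + by move=> w _; exact: hold_pos_ge0.
- by move=> y; exact: rate_inv_ge0.
- by move=> s; exact: path_hold_integral.
Qed.

Lemma ae_pos_holds x : {ae Px x, forall w, forall k, 0 < hold k w}.
Proof.
apply: ae_foralln => k; exists (~` pos_holds k.+1); split.
- by apply: measurableC; exact: measurable_pos_holds.
- have := probability_setC (Px x) (measurable_pos_holds k.+1).
  by rewrite pos_holds_prob1 subee//; exact.
- by move=> w /= H H'; apply: H; exact: H'.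
Qed.

End holding_times.

(** * Hitting times *)

Section hitting.
Context {R : realType} {X : countType}.
Context {d : measure_display} {Omega : measurableType d}.
Variable Gamma : X -> X -> R.
Hypothesis QG : Qmatrix Gamma.
Variables (Px : X -> probability Omega R) (xi : nat -> Omega -> X).
Variable hold : nat -> Omega -> R.
Hypothesis CR : CTMC_realization Gamma Px xi hold.
Implicit Types (A B : set X) (x y : X) (m n k : nat) (w : Omega).
Local Notation avoid_after := (avoid_after xi).

Definition avoid A n : set Omega := [set w | forall k, (k <= n)%N -> ~ A (xi k w)].

Lemma avoidE A n : avoid A n = xi 0%N @^-1` (~` A) `&` avoid_after A 0 n.
Proof.
apply/seteqP; split=> w.
  by move=> H; split=> [|k /andP[_]]; exact: H.
by move=> [H0 H] [|k] kn //; apply: H.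
Qed.

Lemma measurable_avoid A n : measurable (avoid A n).
Proof.
by rewrite avoidE; apply: measurableI;
  [exact: (measurable_xi CR)|exact: (measurable_avoid_after CR)].
Qed.

Definition hold_before A n w : \bar R := (hold_pos hold n \_ (avoid A n)) w.

Definition time_before A w : \bar R := (\sum_(n <oo) hold_before A n w)%E.

Lemma hold_before_ge0 A n w : (0 <= hold_before A n w)%E.
Proof. by rewrite /hold_before patchE; case: ifP => // _; exact: hold_pos_ge0. Qed.

Lemma measurable_hold_before A n : measurable_fun [set: Omega] (hold_before A n).
Proof.
apply/(measurable_restrictT _ (measurable_avoid A n)).
by apply: measurable_funTS; exact: (measurable_hold_pos CR).
Qed.

Lemma time_before_ge0 A w : (0 <= time_before A w)%E.
Proof. by apply: nneseries_ge0 => n _ _; exact: hold_before_ge0. Qed.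

Lemma measurable_time_before A : measurable_fun [set: Omega] (time_before A).
Proof.
apply: (@ge0_emeasurable_sum _ _ _ setT (hold_before A) xpredT).
  by move=> *; exact: hold_before_ge0.
by move=> *; exact: measurable_hold_before.
Qed.

Lemma integral_time_before A x : ~ A x ->
  (\int[Px x]_w time_before A w = potential Gamma A x)%E.
Proof.
move=> Ax; rewrite /time_before integral_nneseries//; last 2 first.
- by move=> n; exact: measurable_hold_before.
- by move=> n w _; exact: hold_before_ge0.
apply: eq_eseriesr => n _.
rewrite -(avoid_hold_integral QG CR n A (B := ~` A) Ax) -avoidE.
by rewrite [RHS]integral_mkcond.
Qed.

Local Notation tau := (hitting_time xi hold).

Lemma hitting_time_ge0 A w : (0 <= tau A w)%E.
Proof. by apply: le_ereal_inf_tmp => _ [t [t0 _] <-]; rewrite lee_fin. Qed.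

Lemma measurable_hitting_time A : measurable_fun [set: Omega] (tau A).
Proof.
(* Holding times may be nonpositive on a null set, but measurability concerns every [w]. [u n] is
   the least [t >= 0] in the [n]-th interval, if any, so the infimum becomes countable. *)
pose J n w := Num.max (jumpT hold n w) 0.
pose u n w : \bar R :=
  if (xi n w \in A) && (J n w < jumpT hold n.+1 w) then (J n w)%:E else +oo%E.
have mJ n : measurable_fun [set: Omega] (jumpT hold n).
  by apply: measurable_sum => k; exact: (measurable_hold CR).
have mJ0 n : measurable_fun [set: Omega] (J n) by exact: measurable_maxr.
have mu n : measurable_fun [set: Omega] (u n).
  apply: measurable_fun_ifT => //; last exact/measurable_EFinP.
  apply: measurable_and; last exact: measurable_fun_ltr.
  apply: (measurable_fun_bool true); rewrite setTI.
  rewrite (_ : _ @^-1` _ = xi n @^-1` A); first exact: (measurable_xi CR).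
  by apply/seteqP; split=> w /= => [/set_mem|/mem_set].
rewrite (_ : tau A = (fun w => einfs (u ^~ w) 0%N)); first exact: measurable_fun_einfs.
apply/funext => w; apply/eqP; rewrite eq_le; apply/andP; split.
  apply: le_ereal_inf_tmp => _ [n _ <-]; rewrite /u.
  case: ifPn => [/andP[/set_mem An Jn]|_]; last by rewrite leey.
  apply: ereal_inf_lbound; exists (J n w) => //=; split.
    by rewrite le_max lexx orbT.
  by exists n; split=> //; rewrite le_max lexx.
apply: le_ereal_inf_tmp => _ [t [t0 [n [Jt [tJ An]]]] <-].
have Jn : J n w <= t by rewrite ge_max Jt t0.
apply: ge_ereal_inf; exists (u n w); first by exists n.
by rewrite /u mem_set//= (le_lt_trans Jn tJ) lee_fin.
Qed.

(** * Trajectories with positive holding times *)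

Section pointwise.
Variables (A : set X) (w : Omega).
Hypothesis hold_gt0 : forall k, 0 < hold k w.

Lemma jumpT_le m n : (m <= n)%N -> jumpT hold m w <= jumpT hold n w.
Proof.
move/subnK <-; elim: (n - m)%N => [//|k IH]; apply: le_trans IH _.
by rewrite addSn /jumpT [leRHS]big_ord_recr/= lerDl ltW.
Qed.

Lemma hitting_time_never : (forall n, ~ A (xi n w)) -> tau A w = +oo%E.
Proof.
move=> H; rewrite /hitting_time -[RHS](@ereal_inf0 R); congr ereal_inf.
by rewrite -subset0 => y [t [_ [n [_ [_ An]]]] _]; exact: (H n An).
Qed.

Lemma time_before_hit n : A (xi n w) -> tau A w = time_before A w.
Proof.
move=> An; pose P m := xi m w \in A.
have exP : exists m, P m by exists n; exact: mem_set.
(* With [n0] the first visit, the hitting time is the [n0]-th jump time, and [avoid A k] holds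
   exactly for [k < n0]. *)
case: (ex_minnP exP) => n0 /set_mem An0 n0_min.
transitivity (jumpT hold n0 w)%:E.
  apply/eqP; rewrite eq_le; apply/andP; split.
    apply: ereal_inf_lbound; exists (jumpT hold n0 w) => //=; split.
      by have := jumpT_le (leq0n n0); rewrite /jumpT big_ord0.
    exists n0; split=> //; split=> //.
    by rewrite /jumpT big_ord_recr/= ltrDl.
  apply: le_ereal_inf_tmp => _ [t [t0 [m [Jt [_ Am]]]] <-].
  rewrite lee_fin; apply: le_trans Jt; apply: jumpT_le.
  by apply: n0_min; exact: mem_set.
rewrite /time_before (nneseries_split 0 n0); last first.
  by move=> k _; exact: hold_before_ge0.
rewrite [X in (_ + X)%E]eseries0 ?adde0 ?add0n; last first.
  move=> k n0k _; rewrite /hold_before patchE memNset// => H.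
  exact: H n0k An0.
rewrite /jumpT -sumEFin big_mkord; apply: eq_bigr => k _.
rewrite /hold_before patchE mem_set; last first.
  move=> i ik Ai; have := n0_min i (mem_set Ai).
  by rewrite leqNgt (leq_ltn_trans ik (ltn_ord k)).
by rewrite /hold_pos max_l// ltW.
Qed.

(** Only an inequality: if [A] is never visited, [time_before] is the explosion time, possibly
    finite, while [tau] is infinite. *)
Lemma time_before_le : (time_before A w <= tau A w)%E.
Proof.
have [[n An]|H] := pselect (exists n, A (xi n w)); first by rewrite (time_before_hit An).
by rewrite hitting_time_never ?leey// => n An; apply: H; exists n.
Qed.

End pointwise.

Lemma potential_le_Etau A x : ~ A x ->
  (potential Gamma A x <= Etau Px xi hold A x)%E.
Proof.
move=> Ax; rewrite -(integral_time_before Ax); apply: ae_ge0_le_integral => //.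
- by move=> w _; exact: time_before_ge0.
- exact: measurable_time_before.
- by move=> w _; exact: hitting_time_ge0.
- exact: measurable_hitting_time.
apply: filterS (ae_pos_holds QG CR x) => w Hw _; exact: time_before_le.
Qed.

(** Almost sure visit of [A] at a step [n >= 1], put in terms of [Qiter] so that it propagates along
    transitions. *)
Definition a_s_hits A x : Prop := forall e : R, 0 < e ->
  exists n, (Qiter Gamma A n (fun=> 1%:E) x <= e%:E)%E.

Lemma Etau_le_potential A x : ~ A x -> a_s_hits A x ->
  (Etau Px xi hold A x <= potential Gamma A x)%E.
Proof.
move=> Ax hitA; rewrite -(integral_time_before Ax); apply: ae_ge0_le_integral => //.
- by move=> w _; exact: hitting_time_ge0.
- exact: measurable_hitting_time.
- by move=> w _; exact: time_before_ge0.
- exact: measurable_time_before.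
have hit : {ae Px x, forall w, exists n, A (xi n w)}.
  exists (\bigcap_n avoid A n); split.
  - by apply: bigcap_measurableType => n _; exact: measurable_avoid.
  - apply/eqP; rewrite eq_le measure_ge0 andbT; apply/lee_addgt0Pr => e e0.
    rewrite add0e; have [n nP] := hitA e e0; apply: le_trans nP.
    rewrite -(avoid_prob QG CR n A (B := ~` A) Ax) -avoidE.
    apply: le_measure; last exact: bigcap_inf.
      by apply/mem_set/bigcap_measurableType => k _; exact: measurable_avoid.
    by apply/mem_set; exact: measurable_avoid.
  - by move=> w /= H n _ k _ Ak; apply: H; exists k.
apply: filterS2 (ae_pos_holds QG CR x) hit => w Hw [n An] _.
by rewrite (time_before_hit Hw An).
Qed.

Lemma Qiter_le A B n x : B `<=` A ->
  (Qiter Gamma A n (fun=> 1%:E) x <= Qiter Gamma B n (fun=> 1%:E) x)%E.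
Proof.
move=> BA; elim: n x => [//|n IH] x /=; apply: le_Pop => // y.
rewrite /kill; case: ifPn => [_|/negP yA].
  by case: ifP => // _; apply: Qiter_ge0 => // _; rewrite lee_fin.
by rewrite ifN//; apply/negP => /set_mem/BA yA'; apply: yA; exact: mem_set.
Qed.

(** * From recurrence to almost sure visits *)

Hypothesis rec : jump_recurrent Px xi.

(** The events of no return within [n] steps decrease to a null event; continuity from above
    concludes. *)
Lemma return_hits x : a_s_hits [set x] x.
Proof.
move=> e e0.
pose F n := xi 0%N @^-1` setT `&` avoid_after [set x] 0 n.
have mF n : measurable (F n).
  by apply: measurableI; [exact: (measurable_xi CR)|exact: (measurable_avoid_after CR)].
have mFF : measurable (\bigcap_n F n) by exact: bigcap_measurableType.
have F0 : Px x (\bigcap_n F n) = 0%E.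
  have -> : \bigcap_n F n = ~` [set w | exists n, (0 < n)%N /\ xi n w = x].
    apply/seteqP; split=> w.
      move=> H [n [n0 xn]]; have [_ /(_ n)] := H n I.
      by rewrite n0 leqnn xn => /(_ erefl)/(_ erefl).
    by move=> H n _; split=> // k /andP[k0 _] xk; apply: H; exists k.
  rewrite probability_setC ?rec ?subee//.
  rewrite (_ : [set w | _] = ~` \bigcap_n F n); first exact: measurableC.
  apply/seteqP; split=> w.
    move=> [n [n0 xn]] H; have [_ /(_ n)] := H n I.
      by rewrite n0 leqnn xn => /(_ erefl)/(_ erefl).
  move=> H; apply: contrapT => H'; apply: H => n _; split=> // k /andP[k0 _] xk.
  by apply: H'; exists k.
have : (fun n => Px x (F n)) @ \oo --> 0%E.
  rewrite -F0; apply: nonincreasing_cvg_mu => //.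
    by rewrite (le_lt_trans (probability_le1 _ (mF 0%N)))// ltry.
  move=> m n mn; apply/subsetPset => w [_ H]; split=> // k /andP[k0 km].
  by apply: H; rewrite k0 (leq_trans km mn).
move=> /fine_cvgP[_ /cvgrPdist_lt/(_ e e0)[N _ /(_ N (leqnn N))]] /=.
rewrite sub0r normrN ger0_norm ?fine_ge0// => lte.
exists N; rewrite -(avoid_prob QG CR N [set x] (B := setT))//.
by rewrite -/(F N) -[leLHS]fineK ?fin_num_measure// lee_fin ltW.
Qed.

Hypothesis irr : jump_irreducible Gamma.

(* The probability of never visiting [z] is a nonnegative function, harmonic even at
   [z] by recurrence, where it vanishes. *)
Lemma recurrent_hits z x : a_s_hits [set z] x.
Proof.
suff H y t : clos_refl_trans X (fun u v => 0 < Pmat Gamma u v) y t ->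
    a_s_hits [set z] y -> a_s_hits [set z] t.
  exact: H (irr z x) (@return_hits z).
elim=> {y t} [y t Pyt hy e e0|//|y t u _ IHt _ IHu hy]; last exact/IHu/IHt.
(* Killing erases the value at [z], so recurrence is used there. For [t <> z],
   [P(y,t) Q^n 1 (t) <= Q^(n+1) 1 (y)], whence the factor [P(y,t)] in the tolerance. *)
have [->|tz] := eqVneq t z; first exact: return_hits.
have [n] := hy (Pmat Gamma y t * e) (mulr_gt0 Pyt e0).
have Q0 m u : (0 <= Qiter Gamma [set z] m (fun=> 1%:E) u)%E.
  by apply: Qiter_ge0 => // _; rewrite lee_fin.
(* For [n = 0] the tolerance is at least 1, and so is [e], as [P(y,t) <= 1]. *)
case: n => [|n] /=.
  rewrite lee_fin => H; exists 0%N; rewrite /= lee_fin; apply: le_trans H _.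
  rewrite ler_piMl ?(ltW e0)//.
  have := @Pop_ge _ _ _ QG (fun=> 1%:E) y t (fun=> lee01).
  by rewrite Pop_cst// mule1 lee_fin.
move=> H; exists n; rewrite -(lee_pmul2l (x := (Pmat Gamma y t)%:E))//; last first.
rewrite -EFinM; apply: le_trans H.
have := @Pop_ge _ _ _ QG (kill [set z] (Qiter Gamma [set z] n (fun=> 1%:E))) y t.
rewrite [X in (_ * X)%E](_ : _ = Qiter Gamma [set z] n (fun=> 1%:E) t).
  by apply => u; exact: kill_ge0.
by rewrite /kill memNset//; exact/eqP.
Qed.

Lemma nonempty_hits A x : A !=set0 -> a_s_hits A x.
Proof.
move=> [z Az] e /(recurrent_hits z x)[n nP]; exists n; apply: le_trans nP.
by apply: Qiter_le => _ ->.
Qed.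

End hitting.

Theorem theorem1p6 (R : realType) (X : countType) (Gamma : X -> X -> R)
  (d : measure_display) (Omega : measurableType d)
  (Px : X -> probability Omega R) (xi : nat -> Omega -> X)
  (hold : nat -> Omega -> R) :
  infinite_set [set: X] ->
  Qmatrix Gamma ->
  jump_irreducible Gamma ->
  CTMC_realization Gamma Px xi hold ->
  jump_recurrent Px xi ->
  (* (1) *)
  ((exists (f : X -> R) (b a eps : R),
      inDomP Gamma f /\
      ereal_sup (range (fun x => (f x)%:E)) = b%:E /\
      0 < a < b /\
      finite_set (sublevel f a) /\
      0 < eps /\
      (forall x, ~ sublevel f a x -> gen Gamma f x <= - eps))
   <->
   (forall A : set X, A !=set0 -> finite_set A ->
      exists CA : R, 0 < CA /\
        (forall x, ~ A x -> (Etau Px xi hold A x <= CA%:E)%E)))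
  /\
  (* (2) *)
  (forall (f : X -> R) (a c eps r : R),
      inDomP Gamma f -> tends_to_infty f ->
      0 < a -> 0 < c -> 0 < eps -> 1 < r ->
      inDomP Gamma (fun x => f x `^ r) ->
      (forall x, ~ sublevel f a x -> - eps <= gen Gamma f x) ->
      (forall x, ~ sublevel f a x ->
         gen Gamma (fun y => f y `^ r) x <= c * f x `^ (r - 1)) ->
      ~ (exists K : R, 0 < K /\
           (forall x, ~ sublevel f a x ->
              (Etau Px xi hold (sublevel f a) x <= K%:E)%E))).

Proof.
move=> infX QG irr CR rec; split.
  split.
    move=> [f [b [a [eps [fD [fb [/andP[a0 ab] [finF [eps0 fgen]]]]]]]]] A A0 finA.
    have f_le x : f x <= b.
      by rewrite -lee_fin -fb; apply: ereal_sup_ubound; exists x.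
    have [C C0 CP] := potential_bounded QG irr A0 fD f_le finF eps0 fgen.
    exists C; split=> // x Ax; apply: le_trans (CP x Ax).
    exact: (Etau_le_potential QG CR Ax (nonempty_hits QG CR rec irr x A0)).
  move=> H; have [z _] := infinite_setN0 infX.
  have [C [C0 CP]] := H [set z] (ex_intro _ z erefl) (finite_set1 z).
  apply: (potential_lyapunov QG (z := z) (C := C) infX) => x /eqP xz.
  by apply: le_trans (CP x xz); exact: (potential_le_Etau QG CR xz).
move=> f a c eps r fD finf a0 c0 eps0 r1 frD genf genfr [K [K0 EK]].
have hit x : ~ sublevel f a x -> a_s_hits Gamma (sublevel f a) x.
  move=> Fx; apply: (nonempty_hits QG CR rec irr).
  (* Were the sublevel set empty, the hitting time would be infinite everywhere, against the bound
     by [K]. *)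
  apply: contrapT => F0; have := EK x Fx; rewrite leNgt => /negP; apply.
  rewrite /Etau (_ : hitting_time _ _ _ = cst +oo%E); last first.
    by apply/funext => w; apply: hitting_time_never => n An; apply: F0; exists (xi n w).
  rewrite integral_cst// [X in (_ * X)%E](_ : _ = 1%E) ?mule1 ?ltry//.
  exact: probability_setT.
have bound := bounded_potential_bound QG fD a0 c0 eps0 r1 frD genf genfr (ltW K0)
  (fun x Fx => le_trans (potential_le_Etau QG CR Fx) (EK x Fx)) hit.
(* As [f] is bounded, all of [X] lies in one of its sublevel sets, finite by [f -> oo]. *)
apply: infX; apply: sub_finite_set (finf `|Num.ceil (a + eps * K)|%N) => x _.
have aN : a + eps * K <= `|Num.ceil (a + eps * K)|%N%:R.
  by rewrite natr_absz (le_trans (ceil_ge _))// ler_int ler_norm.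
apply: le_trans aN; have [Fx|Fx] := pselect (sublevel f a x); last exact: bound.
by apply: le_trans Fx _; rewrite lerDl mulr_ge0// ltW.
Qed.
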